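(* Let $P\subset A$ be an inclusion of unital C*-algebras and let $E\colon A\to P$ be a conditional expectation of index finite type. Suppose that $E$ has the tracial Rokhlin property. If two positive elements $a,b\in P$ satisfy $a\preceq b$ in $A$, then $a\preceq b$ in $P$.
   Context: For positive elements $a,b$ of a C*-algebra $B$, $a\preceq b$ in $B$ (Cuntz subequivalence) means that there is a sequence $(x_k)$ in $B$ with $x_k^*bx_k\to a$. For an inclusion $P\subset A$ of unital C*-algebras (with common unit), a conditional expectation $E\colon A\to P$ is of index finite type (index finite) if there is a finite quasi-basis $\{(u_i,v_i)\}_{i=1}^n\subset A\times A$, i.e. $x=\sum_i u_iE(v_ix)=\sum_iE(xu_i)v_i$ for all $x\in A$; then $\mathrm{Index}\,E=\sum_i u_iv_i$. For a C*-algebra $B$, $B^\infty=\ell^\infty(\mathbb{N},B)/c_0(\mathbb{N},B)$, with $B\subset B^\infty$ via constant sequences; $P^\infty\subset A^\infty$, $A'\cap A^\infty$ is the relative commutant of $A$, and $E^\infty\colon A^\infty\to P^\infty$ is the map induced by applying $E$ entrywise. A conditional expectation $E\colon A\to P$ of index finite has the tracial Rokhlin property if for every nonzero positive $z\in A^\infty$ there exists a projection $e\in A'\cap A^\infty$ such that $(\mathrm{Index}\,E)E^\infty(e)=g$ is a projection, $1-g$ is Murray-von Neumann equivalent to a projection in the hereditary subalgebra of $A^\infty$ generated by $z$, and the map $A\ni x\mapsto xe$ is injective. *)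

(* Defs.v *)
From HB Require Import structures.
From mathcomp Require Import all_boot all_order all_algebra.
From mathcomp Require Import complex.
From mathcomp Require Import all_classical all_reals all_analysis.
Set Implicit Arguments.
Unset Strict Implicit.
Unset Printing Implicit Defensive.
Import Order.TTheory GRing.Theory Num.Theory.
Import numFieldNormedType.Exports.
Import Normc.
Local Open Scope classical_set_scope.
Local Open Scope ring_scope.
Local Open Scope complex_scope.
Local Open Scope quotient_scope.

(* Unital C*-algebras. The norm is an R-valued field of the mixin: the MathComp
   hierarchy has no join of rings and normed Z-modules above [numDomainType], so
   a structure inheriting from both cannot be declared. Every C*-algebra gets its
   canonical [normedModType R[i]] instance below, so that [-->] and [closed]
   refer to the norm topology. As [algType] is built on [nzRingType], 1 != 0. *)
HB.mixin Record isCStarAlgebra (R : realType) A of GRing.Algebra R[i] A := {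
  cnorm : A -> R;
  star : A -> A;
  cnorm_eq0 : forall x, cnorm x = 0 -> x = 0;
  cnormD : forall x y, cnorm (x + y) <= cnorm x + cnorm y;
  cnormZ : forall (c : R[i]) x, cnorm (c *: x) = normc c * cnorm x;
  cnormM : forall x y, cnorm (x * y) <= cnorm x * cnorm y;
  cnorm_complete : forall u : nat -> A,
    (forall eps : R, 0 < eps -> exists N : nat, forall m n : nat,
      (N <= m)%N -> (N <= n)%N -> cnorm (u m - u n) < eps) ->
    exists x : A, cnorm (u n - x) @[n --> \oo] --> (0 : R);
  starK : involutive star;
  starD : {morph star : x y / x + y};
  starZ : forall (c : R[i]) x, star (c *: x) = conjc c *: star x;
  starM : forall x y, star (x * y) = star y * star x;
  cnorm_starM : forall x, cnorm (star x * x) = cnorm x ^+ 2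
}.

#[short(type="cstarAlgType")]
HB.structure Definition CStarAlgebra (R : realType) :=
  {A of GRing.Algebra R[i] A & isCStarAlgebra R A}.

Section CStarTheory.
Variables (R : realType) (A : cstarAlgType R).
Implicit Types x y : A.

Lemma cnorm0 : cnorm (0 : A) = 0.
Proof. by rewrite -(scale0r (0 : A)) cnormZ normc0 mul0r. Qed.

Lemma cnormN x : cnorm (- x) = cnorm x.
Proof. by rewrite -scaleN1r cnormZ normcN normc1 mul1r. Qed.

Lemma cnorm_ge0 x : 0 <= cnorm x.
Proof.
have := cnormD x (- x); rewrite subrr cnorm0 cnormN -mulr2n.
by rewrite pmulrn_lge0.
Qed.

Lemma cnormB x y : cnorm (x - y) <= cnorm x + cnorm y.
Proof. by rewrite (le_trans (cnormD _ _))// cnormN. Qed.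

Lemma star0 : star (0 : A) = 0.
Proof. by apply: (addrI (star 0)); rewrite -starD !addr0. Qed.

Lemma starN x : star (- x) = - star x.
Proof. by apply: (addrI (star x)); rewrite -starD !subrr star0. Qed.

Lemma star1 : star (1 : A) = 1.
Proof. by rewrite -[LHS]mulr1 -[X in _ * X](starK 1) -starM mulr1 starK. Qed.

Lemma cnorm_star x : cnorm (star x) = cnorm x.
Proof.
have le y : cnorm y <= cnorm (star y).
  have [->|y0] := eqVneq y 0; first by rewrite star0 cnorm0.
  have : 0 < cnorm y.
    by rewrite lt_neqAle cnorm_ge0 andbT eq_sym; apply: contra_neq y0 => /cnorm_eq0.
  by move=> y1; rewrite -(ler_pM2r y1) -expr2 -cnorm_starM cnormM.
by apply/eqP; rewrite eq_le le andbT -{2}(starK x) le.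
Qed.

End CStarTheory.

Section FunAlgebra.
Variables (T : pointedType) (K : pzRingType) (A : algType K).

Let scalerAl_fct (c : K) (f g : T -> A) : c *: (f * g) = (c *: f) * g.
Proof. by apply/funext => k; exact: scalerAl. Qed.

Let scalerAr_fct (c : K) (f g : T -> A) : c *: (f * g) = f * (c *: g).
Proof. by apply/funext => k; exact: scalerAr. Qed.

HB.instance Definition _ :=
  GRing.Lmodule_isLalgebra.Build K (T -> A) scalerAl_fct.
HB.instance Definition _ :=
  GRing.Lalgebra_isAlgebra.Build K (T -> A) scalerAr_fct.
End FunAlgebra.


Section CStarNormed.
Variables (R : realType) (A : cstarAlgType R).

Let nrm (x : A) : R[i] := (cnorm x)%:C.

Let nrmD (x y : A) : nrm (x + y) <= nrm x + nrm y.
Proof. by rewrite /nrm -rmorphD lecR cnormD. Qed.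

Let nrmZ (c : R[i]) (x : A) : nrm (c *: x) = `|c| * nrm x.
Proof. by rewrite /nrm cnormZ rmorphM. Qed.

Let nrm_eq0 (x : A) : nrm x = 0 -> x = 0.
Proof. by move=> /(congr1 (@complex.Re R)) /cnorm_eq0. Qed.

HB.instance Definition _ := @Lmodule_isNormed.Build R[i] A nrm nrmD nrmZ nrm_eq0.

Lemma cstar_normE (x : A) : `|x| = (cnorm x)%:C. Proof. by []. Qed.

Lemma cstar_cvgP (u : nat -> A) (a : A) :
  u k @[k --> \oo] --> a <-> cnorm (u k - a) @[k --> \oo] --> (0 : R).
Proof.
split=> [/cvgrPdist_lt h|/cvgrPdist_lt h].
  apply/cvgrPdist_lt => e e0.
  have e0' : 0 < e%:C by rewrite ltcR.
  have := h _ e0'; apply: filterS => k.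
  rewrite cstar_normE ltcR sub0r normrN ger0_norm ?cnorm_ge0//.
  by rewrite -opprB cnormN.
apply/cvgrPdist_lt => e e0.
have : 0 < complex.Re e by case: e e0 => a' b'; rewrite ltcE/= => /andP[].
move=> /h; apply: filterS => k.
rewrite sub0r normrN ger0_norm ?cnorm_ge0// cstar_normE -opprB cnormN => lt1.
case: e e0 lt1 => a' b'; rewrite !ltcE/= => /andP[/eqP -> _] ->.
by rewrite eqxx.
Qed.

End CStarNormed.

Section BoundedSequences.
Variables (R : realType) (A : cstarAlgType R).

Definition bounded_seq : {pred nat -> A} :=
  [pred x : nat -> A | `[< exists M : R, forall k, cnorm (x k) <= M >]].

Lemma bounded_seqP (x : nat -> A) :
  reflect (exists M : R, forall k, cnorm (x k) <= M) (x \in bounded_seq).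
Proof. exact: asboolP. Qed.

Let bounded_subalg : GRing.subalg_closed bounded_seq.
Proof.
split=> [|c x y|x y].
- by apply/bounded_seqP; exists (cnorm (1 : A)).
- move=> /bounded_seqP[M hM] /bounded_seqP[N hN]; apply/bounded_seqP.
  exists (normc c * M + N) => k.
  rewrite (le_trans (cnormD _ _))// lerD// cnormZ ler_wpM2l//.
  by case: c => a b; exact: sqrtr_ge0.
- move=> /bounded_seqP[M hM] /bounded_seqP[N hN]; apply/bounded_seqP.
  exists (M * N) => k.
  by rewrite (le_trans (cnormM _ _))// ler_pM// cnorm_ge0.
Qed.

HB.instance Definition _ :=
  GRing.isSubalgClosed.Build R[i] (nat -> A) bounded_seq bounded_subalg.

(* l^oo(N, A), with pointwise operations, and its ideal c_0(N, A). *)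
Record linf := Linf { linf_seq :> nat -> A; _ : linf_seq \in bounded_seq }.

HB.instance Definition _ := [isSub for linf_seq].
HB.instance Definition _ := [Choice of linf by <:].
HB.instance Definition _ := [SubChoice_isSubAlgebra of linf by <:].

Definition c0 : {pred linf} :=
  [pred x : linf | `[< cnorm (x k) @[k --> \oo] --> (0 : R) >]].

End BoundedSequences.

Arguments bounded_seq {R} A _.
Arguments c0 {R} A _.

Section SequenceAlgebra.
Variables (R : realType) (A : cstarAlgType R).
Implicit Types x y : linf A.

Lemma linfD x y k : (x + y) k = x k + y k. Proof. by []. Qed.
Lemma linfB x y k : (x - y) k = x k - y k. Proof. by []. Qed.
Lemma linfM x y k : (x * y) k = x k * y k. Proof. by []. Qed.
Lemma linfZ (c : R[i]) x k : (c *: x) k = c *: x k. Proof. by []. Qed.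

Lemma linf_bounded x : exists2 M : R, 0 < M & forall k, cnorm (x k) <= M.
Proof.
case: x => x /= /bounded_seqP[M hM]; exists (`|M| + 1).
  by rewrite ltr_pwDr.
by move=> k; rewrite (le_trans (hM k))// ler_wpDr// ler_norm.
Qed.

Lemma c0P x : reflect (forall e : R, 0 < e -> \forall k \near \oo, cnorm (x k) < e)
  (x \in c0 A).
Proof.
apply: (iffP (asboolP _)) => [/cvgrPdist_lt h e e0|h].
  have := h _ e0; apply: filterS => k.
  by rewrite sub0r normrN ger0_norm ?cnorm_ge0.
apply/cvgrPdist_lt => e e0; have := h _ e0; apply: filterS => k.
by rewrite sub0r normrN ger0_norm ?cnorm_ge0.
Qed.

Let c0_zmod : zmod_closed (c0 A).
Proof.
split=> [|x y /c0P hx /c0P hy].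
  by apply/c0P => e e0; apply: nearW => k; rewrite cnorm0.
apply/c0P => e e0; have e2 : 0 < e / 2 by rewrite divr_gt0.
near=> k; rewrite (le_lt_trans (cnormB _ _))// [ltRHS](splitr e) ltrD//.
- by near: k; exact: hx.
- by near: k; exact: hy.
Unshelve. all: by end_near. Qed.

HB.instance Definition _ := GRing.isZmodClosed.Build (linf A) (c0 A) c0_zmod.

Lemma c0Ml x y : x \in c0 A -> y * x \in c0 A.
Proof.
move=> /c0P hx; have [M M0 hM] := linf_bounded y.
apply/c0P => e e0; near=> k; rewrite (le_lt_trans (cnormM _ _))//.
rewrite (@le_lt_trans _ _ (M * cnorm (x k)))//.
  exact: (ler_wpM2r (cnorm_ge0 _) (hM k)).
rewrite mulrC -ltr_pdivlMr//; near: k; apply: hx; exact: divr_gt0.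
Unshelve. all: by end_near. Qed.

Lemma c0Mr x y : x \in c0 A -> x * y \in c0 A.
Proof.
move=> /c0P hx; have [M M0 hM] := linf_bounded y.
apply/c0P => e e0; near=> k; rewrite (le_lt_trans (cnormM _ _))//.
rewrite (@le_lt_trans _ _ (cnorm (x k) * M))//.
  exact: (ler_wpM2l (cnorm_ge0 _) (hM k)).
rewrite -ltr_pdivlMr//; near: k; apply: hx; exact: divr_gt0.
Unshelve. all: by end_near. Qed.

(* A^oo = l^oo(N, A) / c_0(N, A). *)
Definition seqalg := {ideal_quot (c0 A)}.
HB.instance Definition _ := GRing.Zmodule.on seqalg.
HB.instance Definition _ := EqQuotient.on seqalg.

Definition seqpi (x : linf A) : seqalg := \pi_seqalg x.

Lemma seqpiP x y : reflect (seqpi x = seqpi y) (x - y \in c0 A).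
Proof. by rewrite Quotient.idealrBE; exact: eqP. Qed.

Lemma seqpi_repr (q : seqalg) : seqpi (repr q) = q.
Proof. exact: reprK. Qed.

Lemma repr_seqpi x : repr (seqpi x) - x \in c0 A.
Proof. by apply/seqpiP; rewrite seqpi_repr. Qed.

Lemma seqpiD x y : seqpi (x + y) = seqpi x + seqpi y.
Proof. by rewrite /seqpi !piE. Qed.

Lemma linf_star_subproof x : (fun k => star (x k)) \in bounded_seq A.
Proof.
have [M _ hM] := linf_bounded x.
by apply/bounded_seqP; exists M => k; rewrite cnorm_star.
Qed.
Definition linf_star x : linf A := Linf (linf_star_subproof x).

Lemma linf_starB x y : linf_star (x - y) = linf_star x - linf_star y.
Proof.
apply/val_inj/funext => k; transitivity (star (x k - y k)) => //.
by rewrite starD starN.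
Qed.

Lemma c0_star x : x \in c0 A -> linf_star x \in c0 A.
Proof.
move=> /c0P hx; apply/c0P => e /hx.
by apply: filterS => k /=; rewrite cnorm_star.
Qed.

Lemma c0Z (c : R[i]) x : x \in c0 A -> c *: x \in c0 A.
Proof. by rewrite -mulr_algl; exact: c0Ml. Qed.

Definition seq_one : seqalg := seqpi 1.
Definition seq_mul (p q : seqalg) : seqalg := seqpi (repr p * repr q).
Definition seq_scale (c : R[i]) (p : seqalg) : seqalg := seqpi (c *: repr p).
Definition seq_star (p : seqalg) : seqalg := seqpi (linf_star (repr p)).

Lemma seqpi_ind (Q : seqalg -> Prop) : (forall x, Q (seqpi x)) -> forall p, Q p.
Proof. by move=> h p; rewrite -(seqpi_repr p). Qed.

Lemma seq_mulE x y : seq_mul (seqpi x) (seqpi y) = seqpi (x * y).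
Proof.
apply/seqpiP; set x' := repr _; set y' := repr _.
have -> : x' * y' - x * y = (x' - x) * y' + x * (y' - y).
  by rewrite mulrBl mulrBr addrA subrK.
by rewrite rpredD//; [apply: c0Mr|apply: c0Ml]; exact: repr_seqpi.
Qed.

Lemma seq_scaleE c x : seq_scale c (seqpi x) = seqpi (c *: x).
Proof. by apply/seqpiP; rewrite -scalerBr c0Z ?repr_seqpi. Qed.

Lemma seq_starE x : seq_star (seqpi x) = seqpi (linf_star x).
Proof. by apply/seqpiP; rewrite -linf_starB c0_star ?repr_seqpi. Qed.

Let seq_mulA : associative seq_mul.
Proof.
elim/seqpi_ind => x; elim/seqpi_ind => y; elim/seqpi_ind => z.
by rewrite !seq_mulE mulrA.
Qed.
Let seq_mul1l : left_id seq_one seq_mul.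
Proof. by elim/seqpi_ind => x; rewrite seq_mulE mul1r. Qed.
Let seq_mul1r : right_id seq_one seq_mul.
Proof. by elim/seqpi_ind => x; rewrite seq_mulE mulr1. Qed.
Let seq_mulDl : left_distributive seq_mul +%R.
Proof.
elim/seqpi_ind => x; elim/seqpi_ind => y; elim/seqpi_ind => z.
by rewrite -seqpiD !seq_mulE mulrDl seqpiD.
Qed.
Let seq_mulDr : right_distributive seq_mul +%R.
Proof.
elim/seqpi_ind => x; elim/seqpi_ind => y; elim/seqpi_ind => z.
by rewrite -seqpiD !seq_mulE mulrDr seqpiD.
Qed.

Lemma cnorm1 : cnorm (1 : A) = 1.
Proof.
have n0 : cnorm (1 : A) != 0.
  by apply/eqP => /cnorm_eq0/eqP; rewrite oner_eq0.
apply: (mulfI n0); rewrite mulr1 -expr2 -cnorm_starM.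
by rewrite star1 mulr1.
Qed.

Lemma seqpi_eq0 x : (seqpi x = 0) <-> (x \in c0 A).
Proof.
have -> : (0 : seqalg) = seqpi 0 by rewrite /seqpi piE.
by rewrite -[in x \in _](subr0 x); split => /seqpiP.
Qed.

Let seq_one_neq0 : seq_one != 0.
Proof.
apply/eqP => /seqpi_eq0/c0P/(_ 1 ltr01)[N _ /(_ N (leqnn N))] /=.
by rewrite cnorm1 ltxx.
Qed.

HB.instance Definition _ := GRing.Zmodule_isNzRing.Build seqalg
  seq_mulA seq_mul1l seq_mul1r seq_mulDl seq_mulDr seq_one_neq0.

Let seq_scaleA c d p : seq_scale c (seq_scale d p) = seq_scale (c * d) p.
Proof. by elim/seqpi_ind: p => x; rewrite !seq_scaleE scalerA. Qed.
Let seq_scale1 : left_id 1 seq_scale.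
Proof. by elim/seqpi_ind => x; rewrite seq_scaleE scale1r. Qed.
Let seq_scaleDr : right_distributive seq_scale +%R.
Proof.
move=> c; elim/seqpi_ind => x; elim/seqpi_ind => y.
by rewrite -seqpiD !seq_scaleE scalerDr seqpiD.
Qed.
Let seq_scaleDl p : {morph seq_scale^~ p : c d / c + d}.
Proof.
move=> c d; elim/seqpi_ind: p => x.
by rewrite !seq_scaleE scalerDl seqpiD.
Qed.

HB.instance Definition _ := GRing.Zmodule_isLmodule.Build R[i] seqalg
  seq_scaleA seq_scale1 seq_scaleDr seq_scaleDl.

Lemma seqpiM x y : seqpi (x * y) = seqpi x * seqpi y.
Proof. by rewrite -seq_mulE. Qed.
Lemma seqpiZ (c : R[i]) x : seqpi (c *: x) = c *: seqpi x.
Proof. by rewrite -seq_scaleE. Qed.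
Lemma seqpiN x : seqpi (- x) = - seqpi x.
Proof. by rewrite -scaleN1r seqpiZ scaleN1r. Qed.
Lemma seqpiB x y : seqpi (x - y) = seqpi x - seqpi y.
Proof. by rewrite seqpiD seqpiN. Qed.

Let seq_scaleAl (c : R[i]) (p q : seqalg) : c *: (p * q) = (c *: p) * q.
Proof.
elim/seqpi_ind: p => x; elim/seqpi_ind: q => y.
by rewrite -!(seqpiM, seqpiZ) scalerAl.
Qed.
Let seq_scaleAr (c : R[i]) (p q : seqalg) : c *: (p * q) = p * (c *: q).
Proof.
elim/seqpi_ind: p => x; elim/seqpi_ind: q => y.
by rewrite -!(seqpiM, seqpiZ) scalerAr.
Qed.
HB.instance Definition _ := GRing.Lmodule_isLalgebra.Build R[i] seqalg seq_scaleAl.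
HB.instance Definition _ := GRing.Lalgebra_isAlgebra.Build R[i] seqalg seq_scaleAr.

(* The infimum of the eventual upper bounds of the norms, i.e. their limsup; it
   is the infimum of the sup norms over the coset of x modulo c_0, that is, the
   quotient norm. *)
Definition limsup_norm x : R := inf [set M | \forall k \near \oo, cnorm (x k) <= M].
Definition seq_norm (p : seqalg) : R := limsup_norm (repr p).

Let ubs_lb x : lbound [set M : R | \forall k \near \oo, cnorm (x k) <= M] 0.
Proof.
by move=> M [N _ /(_ N (leqnn N))] /=; apply: le_trans; rewrite cnorm_ge0.
Qed.

Lemma limsup_norm_le x (M : R) :
  (\forall k \near \oo, cnorm (x k) <= M) -> limsup_norm x <= M.
Proof. by move=> h; apply: ge_inf => //; exists 0; exact: ubs_lb. Qed.

Let ubs_nonempty x : [set M : R | \forall k \near \oo, cnorm (x k) <= M] !=set0.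
Proof. by have [M _ hM] := linf_bounded x; exists M; exact: nearW. Qed.

Lemma limsup_norm_ge0 x : 0 <= limsup_norm x.
Proof. by apply: lb_le_inf => //; exact: ubs_lb. Qed.

Lemma limsup_norm_lt x (M : R) :
  limsup_norm x < M -> \forall k \near \oo, cnorm (x k) < M.
Proof.
move=> h; have [N hN NM] := inf_lt (ubs_nonempty x) h.
by apply: filterS hN => k /le_lt_trans; exact.
Qed.

Let lsn_near x (e : R) : 0 < e ->
  \forall k \near \oo, cnorm (x k) < limsup_norm x + e.
Proof. by move=> e0; apply: limsup_norm_lt; rewrite ltrDl. Qed.

Lemma limsup_normD x y : limsup_norm (x + y) <= limsup_norm x + limsup_norm y.
Proof.
apply/ler_addgt0Pr => e e0; have e2 : 0 < e / 2 by rewrite divr_gt0.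
apply: limsup_norm_le; near=> k.
rewrite linfD (le_trans (cnormD _ _))// [in leRHS](splitr e) addrACA lerD// ltW//.
- by near: k; exact: lsn_near.
- by near: k; exact: lsn_near.
Unshelve. all: by end_near. Qed.

Lemma limsup_norm_c0 x : (limsup_norm x = 0) <-> (x \in c0 A).
Proof.
split=> [h|/c0P h].
  by apply/c0P => e e0; apply: limsup_norm_lt; rewrite h.
apply/eqP; rewrite eq_le limsup_norm_ge0 andbT; apply/ler_addgt0Pr => e e0.
by rewrite add0r; apply: limsup_norm_le; have := h _ e0; apply: filterS => k /ltW.
Qed.

Lemma seq_normE x : seq_norm (seqpi x) = limsup_norm x.
Proof.
have le y z : y - z \in c0 A -> limsup_norm y <= limsup_norm z.
  move=> /limsup_norm_c0 h.
  by have := limsup_normD (y - z) z; rewrite h add0r subrK.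
apply/eqP; rewrite eq_le !le ?repr_seqpi//.
by rewrite -opprB rpredN repr_seqpi.
Qed.

Let mul_eps (a b z : R) : 0 <= a -> 0 <= b ->
  (forall e, 0 < e -> z <= (a + e) * (b + e)) -> z <= a * b.
Proof.
move=> a0 b0 h; apply/ler_addgt0Pr => e e0.
have d0 : 0 < a + b + 1 by rewrite ltr_wpDl// addr_ge0.
set t := Num.min 1 (e / (a + b + 1)).
have t0 : 0 < t by rewrite lt_min ltr01 divr_gt0.
apply: (le_trans (h _ t0)).
rewrite mulrDl !mulrDr -!addrA lerD2l.
have : t * (a + b + 1) <= e by rewrite -ler_pdivlMr// ge_min lexx orbT.
apply: le_trans; have t1 : t <= 1 by rewrite ge_min lexx.
by rewrite (mulrC a) -!mulrDr ler_wpM2l ?(ltW t0)// addrA lerD2l.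
Qed.

Lemma limsup_normM x y : limsup_norm (x * y) <= limsup_norm x * limsup_norm y.
Proof.
apply: mul_eps; rewrite ?limsup_norm_ge0// => e e0.
apply: limsup_norm_le; near=> k.
rewrite linfM (le_trans (cnormM _ _))//.
apply: ler_pM; rewrite ?cnorm_ge0// ltW//.
- by near: k; exact: lsn_near.
- by near: k; exact: lsn_near.
Unshelve. all: by end_near. Qed.

Let normc_ge0 (c : R[i]) : 0 <= normc c.
Proof. by case: c => a b; exact: sqrtr_ge0. Qed.

Let limsup_normZ_le (c : R[i]) x : limsup_norm (c *: x) <= normc c * limsup_norm x.
Proof.
apply: mul_eps; rewrite ?limsup_norm_ge0 ?normc_ge0// => e e0.
apply: limsup_norm_le; near=> k.
rewrite linfZ cnormZ; apply: ler_pM; rewrite ?cnorm_ge0 ?normc_ge0//.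
  by rewrite lerDl ltW.
by rewrite ltW//; near: k; exact: lsn_near.
Unshelve. all: by end_near. Qed.

Lemma limsup_normZ (c : R[i]) x : limsup_norm (c *: x) = normc c * limsup_norm x.
Proof.
have [->|c0] := eqVneq c 0.
  by rewrite scale0r normc0 mul0r; apply/limsup_norm_c0; rewrite rpred0.
apply/eqP; rewrite eq_le limsup_normZ_le/=.
have nc : 0 < normc c.
  rewrite lt_neqAle normc_ge0 andbT eq_sym.
  by apply: contra_neq c0; exact: eq0_normc.
rewrite mulrC -ler_pdivlMr// -normcV mulrC.
by have := limsup_normZ_le c^-1 (c *: x); rewrite scalerA mulVf// scale1r.
Qed.

Lemma limsup_norm_star x : limsup_norm (linf_star x) = limsup_norm x.
Proof.
rewrite /limsup_norm; congr inf; apply/seteqP; split=> M /=;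
  by apply: filterS => k /=; rewrite cnorm_star.
Qed.

Lemma limsup_norm_starM x :
  limsup_norm (linf_star x * x) = limsup_norm x ^+ 2.
Proof.
apply/eqP; rewrite eq_le; apply/andP; split.
  by rewrite expr2 -[in leRHS](limsup_norm_star x) (le_trans (limsup_normM _ _))//
    !limsup_norm_star.
apply/ler_addgt0Pr => e e0.
set L := limsup_norm (linf_star x * x).
have L0 : 0 <= L + e by rewrite addr_ge0 ?limsup_norm_ge0 ?ltW.
rewrite -(sqr_sqrtr L0) ler_pXn2r ?nnegrE ?sqrtr_ge0 ?limsup_norm_ge0//.
apply: limsup_norm_le.
have := lsn_near (linf_star x * x) e0; apply: filterS => k.
rewrite linfM /= cnorm_starM -/L => /ltW h.
by rewrite -(ler_pXn2r (_ : (0 < 2)%N)) ?nnegrE ?sqrtr_ge0 ?cnorm_ge0// sqr_sqrtr.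
Qed.

Let seq_norm_eq0 (p : seqalg) : seq_norm p = 0 -> p = 0.
Proof.
by elim/seqpi_ind: p => x; rewrite seq_normE => /limsup_norm_c0/seqpi_eq0.
Qed.
Let seq_normD (p q : seqalg) : seq_norm (p + q) <= seq_norm p + seq_norm q.
Proof.
elim/seqpi_ind: p => x; elim/seqpi_ind: q => y.
by rewrite -seqpiD !seq_normE limsup_normD.
Qed.
Let seq_normZ (c : R[i]) (p : seqalg) : seq_norm (c *: p) = normc c * seq_norm p.
Proof. by elim/seqpi_ind: p => x; rewrite -seqpiZ !seq_normE limsup_normZ. Qed.
Let seq_normM (p q : seqalg) : seq_norm (p * q) <= seq_norm p * seq_norm q.
Proof.
elim/seqpi_ind: p => x; elim/seqpi_ind: q => y.
by rewrite -seqpiM !seq_normE limsup_normM.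
Qed.
Let seq_starK : involutive seq_star.
Proof.
elim/seqpi_ind => x; rewrite !seq_starE; congr seqpi.
by apply/val_inj/funext => k; exact: starK.
Qed.
Let seq_starD : {morph seq_star : p q / p + q}.
Proof.
elim/seqpi_ind => x; elim/seqpi_ind => y.
rewrite -seqpiD !seq_starE -seqpiD; congr seqpi.
by apply/val_inj/funext => k; exact: starD.
Qed.
Let seq_starZ (c : R[i]) (p : seqalg) : seq_star (c *: p) = conjc c *: seq_star p.
Proof.
elim/seqpi_ind: p => x.
rewrite -seqpiZ !seq_starE -seqpiZ; congr seqpi.
by apply/val_inj/funext => k; exact: starZ.
Qed.
Let seq_starM (p q : seqalg) : seq_star (p * q) = seq_star q * seq_star p.
Proof.
elim/seqpi_ind: p => x; elim/seqpi_ind: q => y.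
rewrite -seqpiM !seq_starE -seqpiM; congr seqpi.
by apply/val_inj/funext => k; exact: starM.
Qed.
Let seq_norm_starM (p : seqalg) : seq_norm (seq_star p * p) = seq_norm p ^+ 2.
Proof.
by elim/seqpi_ind: p => x; rewrite seq_starE -seqpiM !seq_normE limsup_norm_starM.
Qed.

Let seq_norm_complete (u : nat -> seqalg) :
  (forall eps : R, 0 < eps -> exists N : nat, forall m n : nat,
    (N <= m)%N -> (N <= n)%N -> seq_norm (u m - u n) < eps) ->
  exists p : seqalg, seq_norm (u n - p) @[n --> \oo] --> (0 : R).
Proof.
move=> uC; pose v n := repr (u n).
have uE n : u n = seqpi (v n) by rewrite seqpi_repr.
pose d (i : nat) : R := i.+1%:R^-1.
have d0 i : 0 < d i by rewrite invr_gt0 ltr0n.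
have /choice[N HN] : forall i, exists N, forall m n : nat,
    (N <= m)%N -> (N <= n)%N -> limsup_norm (v m - v n) < d i.
  move=> i; have [N h] := uC _ (d0 i); exists N => m n Nm Nn.
  by rewrite -seq_normE seqpiB -!uE h.
pose p j := (\max_(i < j.+1) N i)%N.
have Np i j : (i <= j)%N -> (N i <= p j)%N.
  by rewrite -ltnS => ij; exact: (leq_bigmax (Ordinal ij)).
pose y j := v (p j).
have y_lt i j : (i <= j)%N -> limsup_norm (y i - y j) < d i.
  by move=> ij; apply: HN; exact: Np.
have /choice[K0 HK0] : forall j, exists K : nat, forall k i, (K <= k)%N ->
    (i <= j)%N -> cnorm (y i k - y j k) < d i.
  move=> j.
  have : \forall k \near \oo, forall i : 'I_j.+1, cnorm (y i k - y j k) < d i.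
    apply: filter_forall => i.
    have h : limsup_norm (y i - y j) < d i by apply: y_lt; rewrite -ltnS.
    exact: limsup_norm_lt h.
  move=> [K _ HK]; exists K => k i Kk ij; rewrite -ltnS in ij.
  exact: (HK k Kk (Ordinal ij)).
pose K j := if j is 0 then 0%N else K0 j.
have HK j k i : (K j <= k)%N -> (i <= j)%N -> cnorm (y i k - y j k) < d i.
  case: j => [|j] /= h; last exact: HK0.
  by rewrite leqn0 => /eqP ->; rewrite subrr cnorm0.
pose fix m k := if k is k'.+1 then
  (if K (m k').+1 <= k'.+1 then (m k').+1 else m k')%N else 0%N.
have Km k : (K (m k) <= k)%N.
  elim: k => //= k IH; case: ifP => // _; exact: leqW.
have mS k : (m k <= m k.+1)%N by rewrite /=; case: ifP.
have m_homo : {homo m : a b / (a <= b)%N}.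
  exact: (homo_leq leqnn leq_trans mS).
have m_unbd i : exists k, (i <= m k)%N.
  elim: i => [|i [k ik]]; first by exists 0%N.
  pose k' := maxn k (K i.+1); exists k'.+1.
  have ik' : (i <= m k')%N by rewrite (leq_trans ik)// m_homo// leq_maxl.
  have [lt|ge] := ltnP i (m k'); first by rewrite (leq_trans lt)// mS.
  have e : m k' = i by apply/eqP; rewrite eqn_leq ge ik'.
  by rewrite /= e (leq_trans (leq_maxr k _) (leqnSn _)).
pose w k := y (m k) k.
have w_bd : w \in bounded_seq A.
  have [M _ hM] := linf_bounded (y 0%N).
  apply/bounded_seqP; exists (M + d 0%N) => k.
  have -> : w k = y 0%N k - (y 0%N k - w k) by rewrite opprB addrC subrK.
  by rewrite (le_trans (cnormB _ _))// lerD// ltW// HK.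
pose W : linf A := Linf w_bd.
have yW i : limsup_norm (y i - W) <= d i.
  have [k0 hk0] := m_unbd i.
  apply: limsup_norm_le; exists k0 => // k /= k0k.
  by rewrite ltW//; apply: HK => //; rewrite (leq_trans hk0)// m_homo.
exists (seqpi W); apply/cvgrPdist_lt => e e0.
have e2 : 0 < e / 2 by rewrite divr_gt0.
have [i hi] : exists i, d i < e / 2.
  exists (Num.truncn (e / 2)^-1); rewrite /d invf_plt ?posrE//.
  by rewrite truncnS_gt.
exists (p i) => // n /= pn.
rewrite sub0r normrN ger0_norm; last first.
  by rewrite uE -seqpiB seq_normE limsup_norm_ge0.
rewrite uE -seqpiB seq_normE.
have -> : v n - W = (v n - y i) + (y i - W) by rewrite addrA subrK.
rewrite (le_lt_trans (limsup_normD _ _))// (splitr e).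
apply: ltrD; last exact: le_lt_trans (yW i) hi.
apply: lt_trans hi; apply: HN; last exact: Np.
exact: leq_trans (Np i i (leqnn i)) pn.
Qed.

HB.instance Definition _ := isCStarAlgebra.Build R seqalg
  seq_norm_eq0 seq_normD seq_normZ seq_normM seq_norm_complete
  seq_starK seq_starD seq_starZ seq_starM seq_norm_starM.

End SequenceAlgebra.

Section Notions.
Variables (R : realType) (A : cstarAlgType R).
Implicit Types (B H P : set A) (a b x y z p q : A).

(* a is a positive element of the C*-subalgebra B. *)
Definition positive_in B a : Prop := exists2 x, B x & a = star x * x.

(* Cuntz subequivalence of a and b in the C*-subalgebra B. *)
Definition cuntz_sub_in B a b : Prop := exists x : nat -> A,
  (forall k, B (x k)) /\ (star (x k) * b * x k @[k --> \oo] --> a).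

(* Not necessarily unital. *)
Record cstar_subalgebra B : Prop := CStarSubalgebra {
  cstar_sub0 : B 0;
  cstar_subD : forall x y, B x -> B y -> B (x + y);
  cstar_subZ : forall (c : R[i]) x, B x -> B (c *: x);
  cstar_subM : forall x y, B x -> B y -> B (x * y);
  cstar_sub_star : forall x, B x -> B (star x);
  cstar_sub_closed : closed B
}.

Definition is_projection p : Prop := star p = p /\ p * p = p.

(* Murray-von Neumann equivalence. *)
Definition mvn_equiv p q : Prop := exists v, star v * v = p /\ v * star v = q.

(* A C*-subalgebra H such that 0 <= x <= y and y in H imply x in H. *)
Definition hereditary H : Prop := cstar_subalgebra H /\
  forall x y, positive_in setT x -> positive_in setT (y - x) -> H y -> H x.

(* The smallest hereditary C*-subalgebra containing z. *)
Definition hereditary_generated z : set A :=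
  [set x | forall H, hereditary H -> H z -> H x].

(* Conditional expectations onto P: positive contractive linear projections that
   are P-bimodule maps. *)
Record condexp P := CondExp {
  condexp_fun :> A -> A;
  condexp_in : forall x, P (condexp_fun x);
  condexp_id : forall p, P p -> condexp_fun p = p;
  condexp_linear : forall (c : R[i]) x y,
    condexp_fun (c *: x + y) = c *: condexp_fun x + condexp_fun y;
  condexp_bimod : forall p q x, P p -> P q ->
    condexp_fun (p * x * q) = p * condexp_fun x * q;
  condexp_pos : forall x,
    positive_in setT x -> positive_in P (condexp_fun x);
  condexp_contr : forall x, cnorm (condexp_fun x) <= cnorm x
}.

Definition quasi_basis P (E : condexp P) n (u v : 'I_n -> A) : Prop :=
  forall x, x = \sum_i u i * E (v i * x) /\ x = \sum_i E (x * u i) * v i.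

Definition index_finite P (E : condexp P) : Prop :=
  exists n (u v : 'I_n -> A), quasi_basis E u v.

(* The value does not depend on the quasi-basis, see [ce_indexE]. *)
Definition ce_index P (E : condexp P) : A :=
  xget 0 [set w | exists n (u v : 'I_n -> A),
    quasi_basis E u v /\ w = \sum_i u i * v i].

Lemma ce_indexE P (E : condexp P) n (u v : 'I_n -> A) :
  quasi_basis E u v -> ce_index E = \sum_i u i * v i.
Proof.
move=> uv; rewrite /ce_index; case: xgetP => [w _ [m [s [t [st ->]]]]|]; last first.
  by move=> /(_ (\sum_i u i * v i)) h; exfalso; apply: h; exists n, u, v.
have vE i : v i = \sum_j E (v i * s j) * t j by have [] := st (v i).
rewrite [RHS](eq_bigr (fun i => \sum_j u i * E (v i * s j) * t j)); last first.
  by move=> i _; rewrite {1}vE mulr_sumr; apply: eq_bigr => j _; rewrite mulrA.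
rewrite exchange_big /=; apply: eq_bigr => j _.
by rewrite -mulr_suml; have [<- _] := uv (s j).
Qed.

Lemma condexpB P (E : condexp P) x y : E (x - y) = E x - E y.
Proof. by rewrite addrC -scaleN1r condexp_linear scaleN1r addrC. Qed.

End Notions.

Section SequenceAlgebraMaps.
Variables (R : realType) (A : cstarAlgType R).

Lemma linf_cst_subproof (a : A) : (fun=> a) \in bounded_seq A.
Proof. by apply/bounded_seqP; exists (cnorm a). Qed.

(* The embedding of [A] into [seqalg A] by constant sequences. *)
Definition seq_cst (a : A) : seqalg A := seqpi (Linf (linf_cst_subproof a)).

(* e is in the relative commutant of A in A^oo. *)
Definition commutes_with_cst (e : seqalg A) : Prop :=
  forall a : A, seq_cst a * e = e * seq_cst a.

Variables (P : set A) (E : condexp P).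

Lemma linf_condexp_subproof (x : linf A) : (fun k => E (x k)) \in bounded_seq A.
Proof.
have [M _ hM] := linf_bounded x; apply/bounded_seqP; exists M => k.
exact: le_trans (condexp_contr E (x k)) (hM k).
Qed.
Definition linf_condexp (x : linf A) : linf A := Linf (linf_condexp_subproof x).

(* E^oo, applying [E] entrywise to any representative, see [condexp_seqE]. Its
   values are the classes of P-valued sequences, that is, P^oo inside A^oo. *)
Definition condexp_seq (q : seqalg A) : seqalg A := seqpi (linf_condexp (repr q)).

Lemma condexp_seqE (x : linf A) : condexp_seq (seqpi x) = seqpi (linf_condexp x).
Proof.
apply/seqpiP/c0P => e e0.
have /c0P/(_ _ e0) := repr_seqpi x; apply: filterS => k.
have -> : (linf_condexp (repr (seqpi x)) - linf_condexp x) k =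
    E ((repr (seqpi x) - x) k) by rewrite [RHS]condexpB.
exact: le_lt_trans (condexp_contr _ _).
Qed.

Definition tracial_rokhlin : Prop :=
  forall z : seqalg A, positive_in setT z -> z != 0 ->
  exists e : seqalg A, let g := seq_cst (ce_index E) * condexp_seq e in
    [/\ is_projection e /\ commutes_with_cst e,
        is_projection g,
        exists2 f : seqalg A, is_projection f /\ hereditary_generated z f &
          mvn_equiv (1 - g) f
      & injective (fun x : A => seq_cst x * e)].

End SequenceAlgebraMaps.

(* Main.v *)
Require Import Defs.
From HB Require Import structures.
From mathcomp Require Import all_boot all_order all_algebra.
From mathcomp Require Import complex.
From mathcomp Require Import all_classical all_reals all_analysis.
From mathcomp Require Import ring lra.

(** The hypothesis is stronger than it looks.  The element z of the sequence
algebra may vanish along a subsequence: for z the class of the indicator of the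
odd indices, every element of the hereditary algebra generated by z vanishes
along the even indices.  Write c for the class of the indicator of the even
indices, a central projection.  The Rokhlin projection e provided for this z
satisfies [c * g = c] ([rokhlin_even_cut]): along the even indices it is an exact
Rokhlin projection.

An exact Rokhlin projection turns a quasi-basis (u, v) into a multiplicative
retraction onto P.  Let w be the index, which is central, and [W = c * w].  The
claim ([rokhlin_compression]) is that [c * x * e = W * E (x * e) * e] for every x.
Put [d y = c * e * y - W * e * E (e * y)].  Expanding with the quasi-basis gives
[\sum_k d (u k) * star (d (star (v k))) = 0], and, d being P-linear on the right,
this reads [\sum_(j, k) d (u j) * Q j k * star (d (u k)) = 0] with the Gram matrix
[Q j k = E (v j * star (v k))].  That matrix is positive, hence
[d (star (v k)) = \sum_j d (u j) * Q j k = 0], which is the claim.  It follows that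
[x |-> W * E (x * e)] is multiplicative on the elements that commute with e, maps
into P, respects star, and sends p in P to [c * p].

If now [star x * b * x] is close to a in A, let y be the image of the constant
sequence x: [star y * b * y - c * a] is the image of [star x * b * x - a], hence
small, and an entry of y at a large even index is the element of P that is
needed ([cuntz_approx]).

Two facts about positive elements are used: [star s * s] is positive in a cone
without lines ([pos_starM], [pos_antisym]), which makes the annihilator of c
hereditary, and a matrix with entries in P that is positive on vectors from P is
positive on vectors from A ([psd_extend]).  Positivity is described by norms
alone, and the only functional calculus is the square root of [1 - x] for
self-adjoint x of norm less than 1, found as a fixed point. *)

Set Implicit Arguments.
Unset Strict Implicit.
Unset Printing Implicit Defensive.
Import Order.TTheory GRing.Theory Num.Theory.
Local Open Scope classical_set_scope.
Local Open Scope ring_scope.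

(** * Norms, adjoints and fixed points *)

Lemma cnorm_scale_real (R : realType) (A : cstarAlgType R) (r : R) (x : A) :
  0 <= r -> cnorm ((r%:C)%C *: x) = r * cnorm x.
Proof. by move=> r0; rewrite cnormZ /= expr0n /= addr0 sqrtr_sqr ger0_norm. Qed.

Lemma cnorm_mulrn (R : realType) (A : cstarAlgType R) (x : A) (n : nat) :
  cnorm (x *+ n) = cnorm x *+ n.
Proof.
rewrite -scaler_nat -(rmorph_nat (real_complex R)) cnorm_scale_real ?ler0n//.
by rewrite mulr_natl.
Qed.

Lemma cnorm_nat (R : realType) (A : cstarAlgType R) (n : nat) :
  cnorm (n%:R : A) = n%:R.
Proof. by rewrite cnorm_mulrn cnorm1. Qed.

Lemma star_mulrn (R : realType) (A : cstarAlgType R) (x : A) (n : nat) :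
  star (x *+ n) = star x *+ n.
Proof. by elim: n => [|n IH]; rewrite ?mulr0n ?star0// !mulrS starD IH. Qed.

Lemma star_nat (R : realType) (A : cstarAlgType R) (n : nat) :
  star (n%:R : A) = n%:R.
Proof. by rewrite star_mulrn star1. Qed.

Lemma starB (R : realType) (A : cstarAlgType R) (x y : A) :
  star (x - y) = star x - star y.
Proof. by rewrite starD starN. Qed.

Lemma star_scale_real (R : realType) (A : cstarAlgType R) (r : R) (x : A) :
  star ((r%:C)%C *: x) = (r%:C)%C *: star x.
Proof. by rewrite starZ /= oppr0. Qed.

Lemma starX (R : realType) (A : cstarAlgType R) (x : A) (n : nat) :
  star (x ^+ n) = star x ^+ n.
Proof. by elim: n => [|n IH]; rewrite ?expr0 ?star1// exprS starM IH -exprSr. Qed.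

Lemma cnorm_eq0P (R : realType) (A : cstarAlgType R) (x : A) :
  (forall e : R, 0 < e -> cnorm x <= e) -> x = 0.
Proof.
move=> h; apply: cnorm_eq0; apply/eqP; rewrite eq_le cnorm_ge0 andbT.
by apply/ler_addgt0Pr => e e0; rewrite add0r h.
Qed.

Lemma cnorm_sumB (R : realType) (A : cstarAlgType R) (x y z : A) :
  cnorm (x - z) <= cnorm (x - y) + cnorm (y - z).
Proof. by rewrite -[x - z](subrKA y) cnormD. Qed.

Lemma cnorm_starM0 (R : realType) (A : cstarAlgType R) (x : A) :
  star x * x = 0 -> x = 0.
Proof.
move=> h; apply: cnorm_eq0; have := cnorm_starM x; rewrite h cnorm0 => /esym/eqP.
by rewrite sqrf_eq0 => /eqP.
Qed.

Lemma cnorm_sa_sqr (R : realType) (A : cstarAlgType R) (x : A) :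
  star x = x -> cnorm (x ^+ 2) = cnorm x ^+ 2.
Proof. by move=> sx; rewrite -cnorm_starM sx expr2. Qed.

(** Iterating the C*-identity: this plays the part of the formula for the
spectral radius of a self-adjoint element. *)
Lemma cnorm_sa_expn2 (R : realType) (A : cstarAlgType R) (x : A) (k : nat) :
  star x = x -> cnorm (x ^+ (2 ^ k)) = cnorm x ^+ (2 ^ k).
Proof.
move=> sx; elim: k => [|k IH]; first by rewrite !expr1.
by rewrite expnS mulnC !exprM cnorm_sa_sqr ?IH// starX sx.
Qed.

(** Banach's fixed point theorem on a ball around 0.  The fixed point comes with
the information that it is a limit of iterates of 0, because self-adjointness and
commutation relations pass from the iterates to it. *)
Lemma contraction_fixpoint (R : realType) (A : cstarAlgType R) (f : A -> A)
    (r q : R) : 0 <= r -> 0 <= q -> q < 1 ->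
  (forall u, cnorm u <= r -> cnorm (f u) <= r) ->
  (forall u v, cnorm u <= r -> cnorm v <= r ->
    cnorm (f u - f v) <= q * cnorm (u - v)) ->
  exists u, [/\ cnorm u <= r, f u = u &
    forall e, 0 < e -> exists n, cnorm (iter n f 0 - u) < e].
Proof.
move=> r0 q0 q1 fr fq; pose w n := iter n f 0.
have w_le n : cnorm (w n) <= r by elim: n => [|n IH]; rewrite ?cnorm0 ?fr.
have w_dist n k : cnorm (w (n + k)%N - w n) <= q ^+ n * r.
  elim: n => [|n IH]; first by rewrite expr0 mul1r subr0 w_le.
  rewrite addSn /= (le_trans (fq _ _ (w_le _) (w_le _)))//.
  by rewrite exprS -mulrA ler_wpM2l.
have w_small e : 0 < e -> exists N, forall n, (N <= n)%N -> cnorm (w n - w N) < e.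
  move=> e0; have q1' : `|q| < 1 by rewrite ger0_norm.
  have r1 : 0 < r + 1 by rewrite ltr_wpDl.
  have /cvgrPdist_lt/(_ _ (divr_gt0 e0 r1))[N _ HN] := cvg_expr q1'.
  exists N => n Nn; rewrite -(subnKC Nn) (le_lt_trans (w_dist _ _))//.
  have := HN N (leqnn N); rewrite /= sub0r normrN ger0_norm ?exprn_ge0//.
  rewrite ltr_pdivlMr//; apply: le_lt_trans.
  by rewrite ler_wpM2l ?exprn_ge0// lerDl.
have [|u /cvgrPdist_lt hu] := @cnorm_complete _ A w.
  move=> e e0; have [N HN] := w_small _ (divr_gt0 e0 (ltr0n _ 2)).
  exists N => m n Nm Nn.
  rewrite (le_lt_trans (cnorm_sumB _ (w N) _))// (splitr e) ltrD ?HN//.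
  by rewrite -opprB cnormN HN.
have wu e : 0 < e -> exists n, cnorm (w n - u) < e /\ cnorm (w n.+1 - u) < e.
  move=> /hu[N _ HN]; exists N.
  have E k : `|0 - cnorm (w k - u)| = cnorm (w k - u).
    by rewrite sub0r normrN ger0_norm ?cnorm_ge0.
  by split; rewrite -E; apply: HN => //=; exact: leqW.
have u_le : cnorm u <= r.
  apply/ler_addgt0Pr => e /wu[n [hn _]].
  have -> : u = w n - (w n - u) by rewrite opprB addrC subrK.
  by rewrite (le_trans (cnormB _ _))// lerD// ltW.
exists u; split=> // [|e /wu[n [hn _]]]; last by exists n.
apply/eqP; rewrite -subr_eq0; apply/eqP/cnorm_eq0P => e e0.
have [n [h1 h2]] := wu _ (divr_gt0 e0 (ltr0n _ 2)).
rewrite (le_trans (cnorm_sumB _ (w n.+1) _))// (splitr e) lerD ?(ltW h2)//.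
rewrite -opprB cnormN /= (le_trans (fq _ _ (w_le _) u_le))//.
by rewrite (le_trans _ (ltW h1))// ler_piMl ?cnorm_ge0 ?ltW.
Qed.

(** If [u = 1 - w] then [u ^+ 2 = 1 - x] says that [w = (x + w ^+ 2) / 2], and the
right hand side contracts the ball of radius [cnorm x] with ratio [cnorm x].  All
iterates are polynomials in x, so u commutes with whatever commutes with x. *)
Lemma sqrt_one_sub (R : realType) (A : cstarAlgType R) (x : A) :
  star x = x -> cnorm x < 1 ->
  exists u : A, [/\ star u = u, u ^+ 2 = 1 - x, cnorm (1 - u) <= 1 &
    forall c, c * x = x * c -> c * u = u * c].
Proof.
move=> sx x1; set q := cnorm x in x1.
have q0 : 0 <= q by exact: cnorm_ge0.
pose f w : A := ((2^-1 : R)%:C)%C *: (x + w ^+ 2).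
have [//|//|//|||u [u_le fu wu]] := @contraction_fixpoint _ A f q q.
- move=> w wq; rewrite cnorm_scale_real ?invr_ge0 ?ler0n// ler_pdivrMl//.
  rewrite mulrDl mul1r (le_trans (cnormD _ _))// lerD2l expr2.
  rewrite (le_trans (cnormM _ _))// -[leRHS]mul1r ler_pM ?cnorm_ge0//.
  exact: le_trans wq (ltW x1).
- move=> w v wq vq; rewrite /f -scalerBr opprD addrACA subrr add0r.
  rewrite cnorm_scale_real ?invr_ge0 ?ler0n// ler_pdivrMl//.
  have -> : w ^+ 2 - v ^+ 2 = w * (w - v) + (w - v) * v.
    by rewrite mulrBr mulrBl !expr2 addrA subrK.
  have -> : 2 * (q * cnorm (w - v)) = q * cnorm (w - v) + cnorm (w - v) * q by ring.
  rewrite (le_trans (cnormD _ _))// lerD//.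
    by rewrite (le_trans (cnormM _ _))// ler_wpM2r ?cnorm_ge0.
  by rewrite (le_trans (cnormM _ _))// ler_wpM2l ?cnorm_ge0.
have u2 : u *+ 2 = x + u ^+ 2.
  rewrite -{1}fu /f -scaler_nat scalerA -(rmorph_nat (real_complex R)) -rmorphM.
  by rewrite divff ?pnatr_eq0// scale1r.
exists (1 - u); split.
- rewrite starB star1; congr (_ - _).
  apply/eqP; rewrite -subr_eq0; apply/eqP/cnorm_eq0P => e e0.
  have [n h1] := wu _ (divr_gt0 e0 (ltr0n _ 2)).
  have sw : star (iter n f 0) = iter n f 0.
    by elim: (n) => [|k IH] /=; rewrite ?star0// star_scale_real starD starX IH sx.
  rewrite (le_trans (cnorm_sumB _ (iter n f 0) _))// (splitr e) lerD ?(ltW h1)//.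
  by rewrite -[X in _ - X]sw -starB cnorm_star -opprB cnormN ltW.
- have -> : x = u *+ 2 - u ^+ 2 by rewrite u2 addrK.
  rewrite expr2 mulrBr mulr1 mulrBl mul1r -expr2 mulr2n.
  by rewrite -addrA -opprD addrA.
- by rewrite opprB addrC subrK (le_trans u_le) ?ltW.
- move=> c cx; rewrite mulrBr mulrBl mulr1 mul1r; congr (_ - _).
  have cw n : c * iter n f 0 = iter n f 0 * c.
    elim: n => [|n IH] /=; first by rewrite mulr0 mul0r.
    rewrite -scalerAr -scalerAl mulrDr mulrDl cx expr2 mulrA IH -mulrA IH.
    by rewrite mulrA.
  apply/eqP; rewrite -subr_eq0; apply/eqP/cnorm_eq0P => e e0.
  have M0 : 0 < 2 * (cnorm c + 1) by rewrite mulr_gt0// ltr_wpDl// cnorm_ge0.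
  have [n h1] := wu _ (divr_gt0 e0 M0); set w := iter n f 0 in h1.
  have -> : c * u - u * c = (w - u) * c - c * (w - u).
    by rewrite mulrBl mulrBr cw opprB [RHS]addrC subrKA.
  rewrite (le_trans (cnormB _ _))//.
  have h : (cnorm c + 1) * cnorm (w - u) <= e / 2.
    rewrite -ler_pdivlMl ?ltr_wpDl ?cnorm_ge0//.
    by rewrite mulrC -mulrA -invfM ltW.
  rewrite (splitr e) lerD// (le_trans _ h)// (le_trans (cnormM _ _))//.
    by rewrite mulrC ler_wpM2r ?cnorm_ge0// lerDl.
  by rewrite ler_wpM2r ?cnorm_ge0// lerDl.
Qed.

Lemma one_sub_right_inverse (R : realType) (A : cstarAlgType R) (y : A) :
  cnorm y < 1 -> exists v, (1 - y) * v = 1.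
Proof.
move=> y1; have y10 : 0 < 1 - cnorm y by rewrite subr_gt0.
have [||//|||v [_ fv _]] := @contraction_fixpoint _ A (fun v => 1 + y * v)
  (1 - cnorm y)^-1 (cnorm y).
- by rewrite invr_ge0 ltW.
- exact: cnorm_ge0.
- move=> u hu; rewrite (le_trans (cnormD _ _))// cnorm1.
  have -> : (1 - cnorm y)^-1 = 1 + cnorm y * (1 - cnorm y)^-1 by field; lra.
  by rewrite lerD2l (le_trans (cnormM _ _))// ler_wpM2l ?cnorm_ge0.
- by move=> u w _ _; rewrite opprD addrACA subrr add0r -mulrBr cnormM.
by exists v; rewrite mulrBl mul1r -{1}fv addrK.
Qed.

(** * The positive cone *)

(** An element whose spectrum lies in the half-line of nonnegative reals,
expressed without spectra: for self-adjoint x, the spectrum lies between 0 and 2n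
exactly when [n - x] has norm at most n. *)
Definition pos (R : realType) (A : cstarAlgType R) (x : A) : Prop :=
  star x = x /\ exists n : nat, cnorm (n%:R - x) <= n%:R.

Lemma posD (R : realType) (A : cstarAlgType R) (x y : A) :
  pos x -> pos y -> pos (x + y).
Proof.
move=> [sx [m hm]] [sy [n hn]]; split; first by rewrite starD sx sy.
exists (m + n)%N; rewrite !natrD opprD addrACA.
by rewrite (le_trans (cnormD _ _))// lerD.
Qed.

Lemma pos_nat (R : realType) (A : cstarAlgType R) (n : nat) : pos (n%:R : A).
Proof. by split; rewrite ?star_nat//; exists n; rewrite subrr cnorm0 ler0n. Qed.

Lemma posMn (R : realType) (A : cstarAlgType R) (x : A) (n : nat) :
  pos x -> pos (x *+ n).
Proof.
move=> px; elim: n => [|n IH]; first exact: (pos_nat A 0).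
by rewrite mulrS; apply: posD.
Qed.

Lemma pos_scale (R : realType) (A : cstarAlgType R) (c : R) (x : A) :
  0 <= c -> pos x -> pos ((c%:C)%C *: x).
Proof.
move=> c0 [sx [n hn]]; split; first by rewrite star_scale_real sx.
pose N := (Num.truncn (c * n%:R)).+1.
have cN : c * n%:R <= N%:R by exact/ltW/truncnS_gt.
exists N.
have -> : N%:R - (c%:C)%C *: x =
    ((N%:R - c * n%:R)%:C)%C *: 1 + (c%:C)%C *: (n%:R - x).
  rewrite scalerBr addrA; congr (_ - _).
  rewrite rmorphB rmorphM scalerBl -scalerA !rmorph_nat !scaler_nat.
  exact/esym/subrK.
rewrite (le_trans (cnormD _ _))// !cnorm_scale_real ?subr_ge0// cnorm1 mulr1.
by rewrite -lerBrDl subKr ler_wpM2l.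
Qed.

Lemma pos_mulrn_inv (R : realType) (A : cstarAlgType R) (x : A) (n : nat) :
  pos (x *+ n.+1) -> pos x.
Proof.
have n0 : 0 <= n.+1%:R^-1 :> R by rewrite invr_ge0.
move=> /(pos_scale n0); rewrite -(scaler_nat _ x) -(rmorph_nat (real_complex R)) scalerA.
by rewrite -rmorphM mulVf ?pnatr_eq0// scale1r.
Qed.

Lemma sqrt_nat_sub (R : realType) (A : cstarAlgType R) (n : nat) (x : A) :
  star x = x -> cnorm x < n%:R ->
  exists u : A, [/\ star u = u, u ^+ 2 = n%:R - x, pos u &
    forall c, c * x = x * c -> c * u = u * c].
Proof.
move=> sx xn; have n0 : 0 < n%:R :> R := le_lt_trans (cnorm_ge0 x) xn.
have ni0 : 0 <= (n%:R : R)^-1 by rewrite invr_ge0 ltW.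
pose x' : A := ((n%:R^-1 : R)%:C)%C *: x.
have [||u [su u2 u1 uc]] := @sqrt_one_sub _ _ x'.
- by rewrite star_scale_real sx.
- by rewrite cnorm_scale_real// ltr_pdivrMl// mulr1.
exists ((Num.sqrt n%:R)%:C%C *: u); split.
- by rewrite star_scale_real su.
- rewrite exprZn -rmorphXn /= sqr_sqrtr ?(ltW n0)// u2 scalerBr scalerA -rmorphM.
  by rewrite divff ?gt_eqF// rmorph1 scale1r rmorph_nat scaler_nat.
- by apply: pos_scale; [exact: sqrtr_ge0|split=> //; exists 1%N].
- by move=> c cx; rewrite -scalerAr -scalerAl uc// -scalerAr -scalerAl cx.
Qed.

(** Both [h + i k] and [h - i k] have squared norm [cnorm (h ^+ 2 + k ^+ 2)], and k
is half their difference up to the factor i. *)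
Lemma cnorm_sqr_le_add (R : realType) (A : cstarAlgType R) (h k : A) :
  star h = h -> star k = k -> h * k = k * h ->
  cnorm k ^+ 2 <= cnorm (h ^+ 2 + k ^+ 2).
Proof.
move=> sh sk hk; set N := cnorm (h ^+ 2 + k ^+ 2).
have nu (c : R[i]) : conjc c = - c -> c ^+ 2 = -1 -> cnorm (h + c *: k) ^+ 2 = N.
  move=> cc c2; rewrite -cnorm_starM starD starZ sh sk cc; congr cnorm.
  rewrite mulrDl !mulrDr -!scalerAl -!scalerAr scalerA hk mulNr -(expr2 c) c2 opprK.
  by rewrite scale1r scaleNr addrA addrK.
have i2 : ('i%C : R[i]) ^+ 2 = -1 by exact: sqr_i.
have ci : conjc 'i%C = - 'i%C :> R[i] by apply/eqP; rewrite eq_complex /= oppr0 !eqxx.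
have N0 : 0 <= N by exact: cnorm_ge0.
have e1 : cnorm (h + 'i%C *: k) = Num.sqrt N.
  by rewrite -(nu _ ci i2) sqrtr_sqr ger0_norm ?cnorm_ge0.
have e2 : cnorm (h + (- 'i%C) *: k) = Num.sqrt N.
  rewrite -(nu (- 'i%C)); last by rewrite sqrrN.
    by rewrite sqrtr_sqr ger0_norm ?cnorm_ge0.
  by rewrite rmorphN; congr (- _).
rewrite -(sqr_sqrtr N0) ler_pXn2r ?nnegrE ?cnorm_ge0 ?sqrtr_ge0//.
have : cnorm ((2 * 'i%C) *: k) <= Num.sqrt N + Num.sqrt N.
  rewrite -{1}e1 -e2; apply: le_trans (cnormB _ _).
  rewrite opprD scaleNr opprK addrACA subrr add0r -scalerDl.
  by rewrite mulr_natl mulr2n.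
rewrite -scalerA scaler_nat cnorm_mulrn cnormZ /=.
by rewrite expr0n /= add0r expr1n sqrtr1 mul1r -mulr2n lerMn2r.
Qed.

(** With [u ^+ 2 = n - h ^+ 2], the element [h + i u] is a multiple of a unitary,
which bounds u. *)
Lemma cnorm_sub_sqr_le (R : realType) (A : cstarAlgType R) (h : A) (n : nat) :
  star h = h -> cnorm h ^+ 2 < n%:R -> cnorm (n%:R - h ^+ 2) <= n%:R.
Proof.
move=> sh hn.
have [||u [su u2 _ uc]] := @sqrt_nat_sub _ _ n (h ^+ 2).
- by rewrite starX sh.
- by rewrite cnorm_sa_sqr.
rewrite -u2 cnorm_sa_sqr//.
have := @cnorm_sqr_le_add _ _ h u sh su; rewrite u2 addrC subrK cnorm_nat.
by apply; apply: uc; rewrite -exprS -exprSr.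
Qed.

Lemma pow2_lin_bound (R : realType) (t D : R) : 0 <= D ->
  (forall k, t ^+ (2 ^ k) <= 1 + (2 ^ k)%:R * D) -> t <= 1.
Proof.
move=> D0 h; rewrite leNgt; apply/negP => t1.
pose d := t - 1; have d0 : 0 < d by rewrite subr_gt0.
have tE : t = 1 + d by rewrite addrC subrK.
have bern n : 1 + n%:R * d <= t ^+ n.
  elim: n => [|n IH]; first by rewrite mul0r addr0 expr0.
  rewrite exprSr; apply: le_trans (ler_wpM2r _ IH); last by rewrite ltW// tE ltr_wpDl.
  rewrite [in leRHS]tE -natr1.
  have -> : (1 + n%:R * d) * (1 + d) = 1 + (n%:R + 1) * d + n%:R * (d * d) by ring.
  by rewrite lerDl !mulr_ge0 ?ler0n ?(ltW d0).
have key k : (2 ^ k)%:R * d ^+ 2 <= 2 * D.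
  set n := (2 ^ k)%N; have n0 : 0 < (n%:R : R) by rewrite ltr0n expn_gt0.
  have := h k.+1; rewrite expnSr exprM natrM -/n => h1.
  have h2 : (1 + n%:R * d) ^+ 2 <= (t ^+ n) ^+ 2.
    rewrite ler_pXn2r ?nnegrE ?bern// ?exprn_ge0//.
      by rewrite addr_ge0// mulr_ge0 ?ler0n ?(ltW d0).
    by rewrite (le_trans ler01)// ltW.
  have h3 := le_trans h2 h1.
  rewrite -(ler_pM2l n0).
  have : 0 <= n%:R * d by rewrite mulr_ge0 ?ler0n ?(ltW d0).
  have -> : n%:R * (n%:R * d ^+ 2) = (1 + n%:R * d) ^+ 2 - 1 - 2 * (n%:R * d) by ring.
  have -> : n%:R * (2 * D) = n%:R * 2 * D by ring.
  lra.
pose m := Num.truncn (2 * D / d ^+ 2).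
have : (2 * D / d ^+ 2) < (2 ^ m)%:R.
  apply: lt_le_trans (truncnS_gt _) _; rewrite ler_nat; exact: ltn_expl.
by rewrite ltr_pdivrMr ?exprn_gt0// ltNge key.
Qed.

(** The spectra of [star y * y] and [y * star y] agree up to 0; here the upper end
of the spectrum is read off from the norm of a translate.  With B and C the two
translates, [C ^+ k.+1 = r * C ^+ k + y * B ^+ k * star y], so that the norm of
[C ^+ k] exceeds that of [n ^+ k] by a factor at most linear in k, and for
self-adjoint C such a factor disappears along the powers of 2. *)
Lemma cnorm_shift_star (R : realType) (A : cstarAlgType R) (y : A) (r n : nat) :
  (r <= n)%N -> cnorm (r%:R + star y * y) <= n%:R ->
  cnorm (r%:R + y * star y) <= n%:R.
Proof.
case: n => [|n] rn hB.
  move: rn; rewrite leqn0 => /eqP r0; move: hB; rewrite r0 !add0r.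
  move=> h; have yy0 : star y * y = 0.
    by apply: cnorm_eq0; apply/eqP; rewrite eq_le h cnorm_ge0.
  by rewrite (cnorm_starM0 yy0) mul0r cnorm0.
set B := _ + star y * y in hB; set C := _ + y * star y; set m := n.+1 in rn hB *.
have m0 : 0 < (m%:R : R) by rewrite ltr0n.
have CyB : C * y = y * B.
  by rewrite mulrDl mulrDr mulrA mulr_natl mulr_natr.
have CyBk k : C ^+ k * y = y * B ^+ k.
  elim: k => [|k IH]; first by rewrite mul1r mulr1.
  by rewrite exprS -mulrA IH mulrA CyB -mulrA -exprS.
have Bk k : cnorm (B ^+ k) <= m%:R ^+ k.
  elim: k => [|k IH]; first by rewrite !expr0 cnorm1.
  by rewrite !exprS (le_trans (cnormM _ _))// ler_pM ?cnorm_ge0.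
pose D := cnorm y ^+ 2 / m%:R.
have D0 : 0 <= D by rewrite divr_ge0 ?sqr_ge0 ?ler0n.
have Ck k : cnorm (C ^+ k) <= (1 + k%:R * D) * m%:R ^+ k.
  elim: k => [|k IH]; first by rewrite !expr0 cnorm1 mul0r addr0 mulr1.
  have -> : C ^+ k.+1 = (C ^+ k) *+ r + y * B ^+ k * star y.
    by rewrite exprSr mulrDr mulr_natr mulrA CyBk.
  rewrite (le_trans (cnormD _ _))// cnorm_mulrn.
  have h1 : cnorm (C ^+ k) *+ r <= m%:R * ((1 + k%:R * D) * m%:R ^+ k).
    by rewrite -[leLHS]mulr_natl ler_pM ?cnorm_ge0 ?ler0n ?ler_nat.
  have h2 : cnorm (y * B ^+ k * star y) <= m%:R * D * m%:R ^+ k.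
    rewrite (le_trans (cnormM _ _))// cnorm_star.
    rewrite (@le_trans _ _ (cnorm y * m%:R ^+ k * cnorm y))//.
      rewrite ler_wpM2r ?cnorm_ge0// (le_trans (cnormM _ _))//.
      by rewrite ler_wpM2l ?cnorm_ge0.
    by rewrite /D mulrCA divff ?gt_eqF// mulr1 expr2 mulrAC.
  rewrite (le_trans (lerD h1 h2))// exprS -natr1.
  by have -> // : forall a b c d : R, a * ((1 + b * c) * d) + a * c * d =
    (1 + (b + 1) * c) * (a * d) by move=> *; ring.
have sC : star C = C by rewrite starD star_nat starM starK.
rewrite -[leRHS]mul1r -ler_pdivrMr//; apply: (pow2_lin_bound D0) => k.
rewrite expr_div_n ler_pdivrMr ?exprn_gt0// -cnorm_sa_expn2//.
Qed.

Lemma ler_arch (R : realType) (t s b : R) :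
  (forall m : nat, m%:R * t <= m%:R * s + b) -> t <= s.
Proof.
move=> h; rewrite leNgt; apply/negP => st.
have d0 : 0 < t - s by rewrite subr_gt0.
have := h (Num.truncn (b / (t - s))).+1; rewrite -lerBlDl -mulrBr.
by rewrite -ler_pdivlMr// leNgt truncnS_gt.
Qed.

Lemma pos_sqr (R : realType) (A : cstarAlgType R) (h : A) :
  star h = h -> pos (h ^+ 2).
Proof.
move=> sh; split; first by rewrite starX sh.
by exists (Num.truncn (cnorm h ^+ 2)).+1; apply: cnorm_sub_sqr_le => //; exact: truncnS_gt.
Qed.

Lemma pos_sqrt (R : realType) (A : cstarAlgType R) (x : A) : pos x ->
  exists h : A, [/\ star h = h, h ^+ 2 = x + 1, pos h &
    forall c, c * x = x * c -> c * h = h * c].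
Proof.
move=> [sx [n hn]].
have [||h [sh h2 ph hc]] := @sqrt_nat_sub _ _ n.+1 (n%:R - x).
- by rewrite starB star_nat sx.
- by rewrite (le_lt_trans hn)// ltr_nat.
exists h; split=> //; first by rewrite h2 opprB addrCA -natr1 addrAC subrr add0r.
by move=> c cx; apply: hc; rewrite mulrBr mulrBl cx mulr_natl mulr_natr.
Qed.

(** The witness in [pos] can be any integer above the norm: replacing x by a large
multiple, whose translate by 1 is a square, removes the error coming from that
translation. *)
Lemma pos_cnorm_sub (R : realType) (A : cstarAlgType R) (x : A) (n : nat) :
  pos x -> cnorm x < n%:R -> cnorm (n%:R - x) <= n%:R.
Proof.
move=> px xn; apply: (@ler_arch _ _ _ 3) => m.
have [h [sh h2 _ _]] := pos_sqrt (posMn m px).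
have hn : cnorm h ^+ 2 < (m * n + 2)%:R.
  rewrite -cnorm_sa_sqr// h2 (le_lt_trans (cnormD _ _))// cnorm_mulrn cnorm1.
  rewrite natrD natrM -[cnorm x *+ m]mulr_natl.
  have : m%:R * cnorm x <= m%:R * n%:R by rewrite ler_wpM2l// ltW.
  lra.
have := cnorm_sub_sqr_le sh hn; rewrite h2 => hle.
have E : (n%:R - x) *+ m = ((m * n + 2)%:R - (x *+ m + 1)) - 1.
  rewrite natrD opprD addrACA (natrD _ 1 1) !addrK.
  by rewrite mulrnBl mulnC natrM mulr_natr.
rewrite mulr_natl -cnorm_mulrn E (le_trans (cnormB _ _))// cnorm1.
move: hle; rewrite natrD natrM; lra.
Qed.

(** The archimedean property of the cone: positivity of [x + b / m] for all m
passes to the limit.  Applied with b a unit or a square, it removes the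
regularizations needed to extract square roots and inverses. *)
Lemma pos_arch (R : realType) (A : cstarAlgType R) (x b : A) :
  (forall m : nat, pos (x *+ m + b)) -> pos x.
Proof.
move=> h; have [sb _] := h 0%N; rewrite mulr0n add0r in sb.
have [sx _] := h 1%N; split.
  by move: sx; rewrite mulr1n starD sb => /addIr.
pose n := (Num.truncn (cnorm x)).+1; pose N := (Num.truncn (cnorm b)).+1.
exists n; apply: (@ler_arch _ _ _ (N%:R + cnorm (N%:R - b))) => m.
have hn : cnorm (x *+ m + b) < (m * n + N)%:R.
  rewrite (le_lt_trans (cnormD _ _))// natrD ler_ltD ?truncnS_gt//.
  by rewrite cnorm_mulrn natrM -[leLHS]mulr_natl ler_wpM2l// ltW// truncnS_gt.
have := pos_cnorm_sub (h m) hn => hle.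
have E : (n%:R - x) *+ m = ((m * n + N)%:R - (x *+ m + b)) - (N%:R - b).
  rewrite natrD opprD addrACA addrK.
  by rewrite mulrnBl mulnC natrM mulr_natr.
rewrite mulr_natl -cnorm_mulrn E (le_trans (cnormB _ _))//.
by move: hle; rewrite natrD natrM; lra.
Qed.

Lemma pos_inv (R : realType) (A : cstarAlgType R) (x : A) : pos x ->
  exists v : A, [/\ star v = v, v * (x + 1) = 1 & (x + 1) * v = 1].
Proof.
move=> [sx [n hn]]; pose c : R := n.+1%:R^-1.
have c0 : 0 <= c by rewrite invr_ge0.
have [|v hv] := @one_sub_right_inverse _ _ ((c%:C)%C *: (n%:R - x)).
  by rewrite cnorm_scale_real// ltr_pdivrMl// mulr1 (le_lt_trans hn)// ltr_nat.
have xv : (x + 1) * ((c%:C)%C *: v) = 1.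
  rewrite -[RHS]hv -scalerAr scalerAl; congr (_ * _).
  have c1 : (c%:C)%C *: (n.+1%:R : A) = 1.
    rewrite -scaler_nat -(rmorph_nat (real_complex R)) scalerA -rmorphM.
    by rewrite mulVf ?pnatr_eq0// scale1r.
  rewrite -[X in _ = X - _]c1 -scalerBr; congr (_ *: _).
  by rewrite -natr1 opprB [RHS]addrC addrA subrK.
exists ((c%:C)%C *: v); set u := _ *: v in xv *.
have ux : star u * (x + 1) = 1.
  by have /(congr1 (@star _ A)) := xv; rewrite starM starD star1 sx.
have su : star u = u by rewrite -[LHS]mulr1 -[X in _ * X]xv mulrA ux mul1r.
by split=> //; rewrite -{1}su.
Qed.

Lemma inv_commute (S : nzRingType) (z v c : S) :
  v * z = 1 -> z * v = 1 -> c * z = z * c -> c * v = v * c.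
Proof.
by move=> vz zv cz; rewrite -[LHS]mul1r -vz -mulrA (mulrA z) -cz -mulrA zv mulr1.
Qed.

Lemma pos_conj_comm (R : realType) (A : cstarAlgType R) (x g : A) :
  pos x -> star g = g -> g * x = x * g -> pos (g * x * g).
Proof.
move=> px sg gx; apply: (@pos_arch _ _ _ (g ^+ 2)) => m.
have [h [sh h2 _ hc]] := pos_sqrt (posMn m px).
have gh : g * h = h * g by apply: hc; rewrite mulrnAr gx mulrnAl.
have -> : (g * x * g) *+ m + g ^+ 2 = (g * h) ^+ 2.
  rewrite (expr2 (g * h)) [X in _ = _ * X]gh mulrA -(mulrA g h) -(expr2 h) h2.
  by rewrite mulrDr mulrDl mulr1 mulrnAr mulrnAl.
by apply: pos_sqr; rewrite starM sh sg.
Qed.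

Lemma pos_mul (R : realType) (A : cstarAlgType R) (x y : A) :
  pos x -> pos y -> x * y = y * x -> pos (x * y).
Proof.
move=> px py xy; apply: (@pos_arch _ _ _ x) => m.
have [g [sg g2 _ gc]] := pos_sqrt (posMn m py).
have xg : x * g = g * x by apply: gc; rewrite mulrnAr xy mulrnAl.
have -> : (x * y) *+ m + x = g * x * g.
  by rewrite -xg -mulrA -(expr2 g) g2 mulrDr mulr1 mulrnAr.
by apply: pos_conj_comm.
Qed.

(** Monotonicity of the norm on the cone, up to a constant that comes from taking
the square roots of [x + 1] and [y - x + 1] instead of those of x and [y - x]. *)
Lemma pos_cnorm_le (R : realType) (A : cstarAlgType R) (x y : A) :
  pos x -> pos (y - x) -> x * y = y * x -> cnorm x <= cnorm y + 3.
Proof.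
move=> px pyx xy.
have [h [sh h2 _ hc]] := pos_sqrt px; have [g [sg g2 _ gc]] := pos_sqrt pyx.
have gh : g * h = h * g.
  apply: hc; apply/esym/gc.
  by rewrite mulrBr mulrBl xy.
have := cnorm_sqr_le_add sg sh gh.
rewrite -cnorm_sa_sqr// h2 g2 addrACA subrK => hle.
have -> : x = x + 1 - 1 by rewrite addrK.
rewrite (le_trans (cnormB _ _))// (le_trans (lerD hle (lexx _)))//.
rewrite (le_trans (lerD (cnormD _ _) (lexx _)))// cnorm1 -(natrD _ 1 1) cnorm_nat.
by rewrite -addrA lerD2l -(natrD _ 2 1).
Qed.

Lemma pos_antisym (R : realType) (A : cstarAlgType R) (x : A) :
  pos x -> pos (- x) -> x = 0.
Proof.
move=> px pnx; apply: cnorm_eq0P => e e0; rewrite (le_trans _ (ltW e0))//.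
apply: (@ler_arch _ _ _ 3) => m.
rewrite mulr0 add0r mulr_natl -cnorm_mulrn.
have := @pos_cnorm_le _ _ (x *+ m) 0 (posMn m px).
rewrite sub0r -mulNrn mul0r mulr0 cnorm0 add0r; apply => //.
exact: posMn.
Qed.

(** With h and l twice the real and imaginary parts of y, up to sign, this is half
of [h ^+ 2 + l ^+ 2]. *)
Lemma pos_star_add (R : realType) (A : cstarAlgType R) (y : A) :
  pos (y * star y + star y * y).
Proof.
pose h := y + star y; pose l := 'i%C *: (y - star y).
have sh : star h = h by rewrite starD starK addrC.
have sl : star l = l.
  rewrite starZ starB starK -opprB scalerN -scaleNr; congr (_ *: _).
  by apply/eqP; rewrite eq_complex /= opprK oppr0 !eqxx.
apply: (@pos_mulrn_inv _ _ _ 1).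
suff <- : h ^+ 2 + l ^+ 2 = (y * star y + star y * y) *+ 2.
  by apply: posD; apply: pos_sqr.
rewrite exprZn sqr_i scaleN1r (expr2 (y + _)) (expr2 (y - _)).
rewrite !mulrDl !mulrDr !mulNr !mulrN opprK.
set a := y * y; set b := y * star y; set c := star y * y; set d := star y * _.
have -> : a + b + (c + d) = a + d + (b + c) by rewrite (addrC c) addrACA.
have -> : a - b + (- c + d) = a + d - (b + c) by rewrite (addrC (- c)) addrACA opprD.
by rewrite opprB [LHS]addrC subrKA mulr2n.
Qed.

(** A bound from above for [star y * y] transfers to [y * star y] and then bounds
[star y * y] from below, the sum of the two being positive. *)
Lemma pos_opp_starM (R : realType) (A : cstarAlgType R) (y : A) :
  pos (1 - star y * y) -> pos (1 + star y * y).
Proof.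
move=> p1; pose n := Num.truncn (cnorm (1 - star y * y)).
have := @pos_cnorm_sub _ _ _ n.+1 p1 (truncnS_gt _).
have E (z : A) : n.+1%:R - (1 - z) = n%:R + z by rewrite -natr1 opprB addrACA subrr addr0.
rewrite E => hn; have hn' := @cnorm_shift_star _ _ y n n.+1 (leqnSn n) hn.
have p2 : pos (1 - y * star y).
  split; first by rewrite starB star1 starM starK.
  by exists n.+1; rewrite E.
have := posD p2 (pos_star_add y).
by rewrite addrA subrK.
Qed.

(** The theorem of Fukamiya and Kaplansky.  Cut [a = star t * t] down to its
negative part: with [k ^+ 2 = a ^+ 2 + 1] and [p = k - a], which is close to twice
the negative part of a, the element [y = t * p] satisfies
[2 star y * y = p - p ^+ 3], which is bounded above by an absolute constant.  By
[pos_opp_starM] it is bounded below too, so that p has norm at most 2 and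
[a + 2 = k + (2 - p)] is positive.  The constant does not depend on s, and t runs
over the multiples of s. *)
Lemma pos_starM (R : realType) (A : cstarAlgType R) (s : A) : pos (star s * s).
Proof.
apply: (@pos_arch _ _ _ 2) => m.
(* it is enough to bound [star t * t] from below by -2, for every multiple t of s *)
pose t := ((Num.sqrt m%:R)%:C)%C *: s.
have -> : (star s * s) *+ m = star t * t.
  rewrite star_scale_real -scalerAl -scalerAr scalerA -rmorphM -expr2 sqr_sqrtr//.
  by rewrite rmorph_nat scaler_nat.
set a := star t * t; have sa : star a = a by rewrite starM starK.
have [k [sk k2 pk kc]] := pos_sqrt (pos_sqr sa).
have ka : a * k = k * a by apply: kc; rewrite -exprS -exprSr.
pose p := k - a.
have sp : star p = p by rewrite starB sk sa.
have pk' : p * k = k * p by rewrite mulrBl mulrBr ka.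
(* [k ^+ 2 - a ^+ 2 = 1], so p is the inverse of [k + a] *)
have inv_p : p * (k + a) = 1.
  by rewrite mulrBl !mulrDr ka opprD addrACA subrKA -!expr2 k2 [X in X - _]addrC addrK.
have twice : p ^+ 2 + 1 = (k * p) *+ 2.
  by rewrite expr2 -inv_p -mulrDr /p addrACA addNr addr0 -mulr2n mulrnAr -/p pk'.
have [v [sv vk kv]] := pos_inv (pos_sqr sa); rewrite -k2 in vk kv.
have comm_v c : c * k = k * c -> c * v = v * c.
  by move=> ck; apply: (inv_commute vk kv); rewrite expr2 mulrA ck -mulrA ck mulrA.
have pv : pos v.
  have -> : v = (v * k) ^+ 2.
    rewrite expr2 mulrA -(mulrA v k v) (comm_v k erefl) mulrA.
    by rewrite -(mulrA _ k k) -expr2 -mulrA vk mulr1.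
  by apply: pos_sqr; rewrite starM sk sv (comm_v k erefl).
(* [2 p = (p ^+ 2 + 1) / k], a product of commuting positive elements *)
have pp : pos p.
  apply: (@pos_mulrn_inv _ _ _ 1).
  have -> : p *+ 2 = (p ^+ 2 + 1) * k * v.
    rewrite twice mulrnAl mulrnAl -pk' -(mulrA p k k) -(expr2 k).
    by rewrite -(mulrA p) kv mulr1.
  have p2k : (p ^+ 2 + 1) * k = k * (p ^+ 2 + 1).
    by rewrite mulrDl mulrDr mul1r mulr1 expr2 -mulrA pk' mulrA pk' mulrA.
  apply: pos_mul => //; last first.
    by apply: comm_v; rewrite mulrA -p2k.
  apply: pos_mul => //; apply: posD; first exact: pos_sqr.
  exact: (pos_nat A 1).
pose y := t * p.
have yy : (star y * y) *+ 2 = p - p ^+ 3.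
  have a2 : a *+ 2 = (k + a) - p by rewrite /p opprB [RHS]addrC subrKA mulr2n.
  rewrite starM sp -mulrA (mulrA (star t)) -/a mulrA -mulrnAl -mulrnAr a2.
  by rewrite (mulrBr p (k + a)) inv_p mulrBl mul1r -expr2 -exprSr.
have pE : p = k - a by [].
clearbody p.
pose f : {rmorphism {poly R[i]} -> A} := horner_alg p.
have fX : f 'X = p by exact: horner_algX.
have fE := (rmorphB f, rmorphD f, rmorphM f, rmorph1 f, rmorphXn f, rmorph_nat f, fX).
have p1s : star (p - 1) = p - 1 by rewrite starB sp star1.
have p1c : (p - 1) * p = p * (p - 1) by rewrite mulrBl mulrBr mul1r mulr1.
have Y1 : pos (1 - star y * y).
  apply: (@pos_mulrn_inv _ _ _ 1); rewrite mulrnBl yy.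
  have -> : 2 - (p - p ^+ 3) = (p - 1) * p * (p - 1) + p ^+ 2 + (p - 1) ^+ 2 + 1.
    have /(congr1 f) : 2 - ('X - 'X ^+ 3) =
      ('X - 1) * 'X * ('X - 1) + 'X ^+ 2 + ('X - 1) ^+ 2 + 1 :> {poly R[i]} by ring.
    by rewrite !fE.
  apply: posD (pos_nat A 1); apply: posD; last exact: pos_sqr.
  by apply: posD; [exact: pos_conj_comm|exact: pos_sqr].
have Y2 : pos (2 + p - p ^+ 3).
  have := posMn 2 (pos_opp_starM Y1); rewrite mulrnDl yy.
  by rewrite addrA.
have p3 : pos (p ^+ 3) by rewrite exprSr expr2; apply: pos_conj_comm.
have p3c : p ^+ 3 * (2 + p) = (2 + p) * p ^+ 3.
  by rewrite mulrDl mulrDr mulr_natl mulr_natr -exprS -exprSr.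
(* [p ^+ 3 <= p + 2] bounds the norm of p by a root of a cubic *)
have pN : cnorm p <= 2.
  have h3 : cnorm (p ^+ 3) <= cnorm p + 5.
    rewrite (le_trans (pos_cnorm_le p3 Y2 p3c))//.
    have := cnormD (2 : A) p; rewrite cnorm_nat; lra.
  have h4 : cnorm p ^+ 4 <= cnorm p * cnorm (p ^+ 3).
    by rewrite -(@cnorm_sa_expn2 _ _ p 2)// -[X in p ^+ X]/(1 + 3)%N exprD cnormM.
  rewrite leNgt; apply/negP => p2.
  have h5 : cnorm p * cnorm (p ^+ 3) <= cnorm p * (cnorm p + 5).
    by rewrite ler_wpM2l ?cnorm_ge0.
  have h6 : cnorm p * cnorm p ^+ 3 <= cnorm p * (cnorm p + 5).
    by rewrite -exprS (le_trans h4).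
  move: h6; rewrite ler_pM2l; last by lra.
  nra.
have -> : a + 2 = k + (2 - p).
  by rewrite pE opprB [RHS]addrCA [RHS]addrC; congr (_ + _); rewrite [RHS]addrC subrK.
apply: posD => //; split; first by rewrite starB star_nat sp.
by exists 2%N; rewrite opprB addrC subrK.
Qed.

Lemma pos_conj (R : realType) (A : cstarAlgType R) (b s : A) :
  pos b -> pos (s * b * star s).
Proof.
move=> pb; apply: (@pos_arch _ _ _ (s * star s)) => m.
have [h [sh h2 _ _]] := pos_sqrt (posMn m pb).
have -> : (s * b * star s) *+ m + s * star s = star (h * star s) * (h * star s).
  rewrite starM starK sh [RHS]mulrA -(mulrA s h h) -(expr2 h) h2 mulrDr mulr1 mulrDl.
  by rewrite mulrnAr mulrnAl.
exact: pos_starM.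
Qed.

Lemma pos_mulstar (R : realType) (A : cstarAlgType R) (s : A) : pos (s * star s).
Proof. by rewrite -{1}(starK s); apply: pos_starM. Qed.

Lemma pos_sum (R : realType) (A : cstarAlgType R) (I : finType) (P : pred I)
  (F : I -> A) : (forall i, P i -> pos (F i)) -> pos (\sum_(i | P i) F i).
Proof. by move=> h; elim/big_ind: _ => //; [exact: (pos_nat A 0)|exact: posD]. Qed.

Lemma starM_add_eq0 (R : realType) (A : cstarAlgType R) (s t : A) :
  star s * s + star t * t = 0 -> s = 0.
Proof.
move=> st; apply: cnorm_starM0; apply: pos_antisym; first exact: pos_starM.
have -> : - (star s * s) = star t * t by apply/eqP; rewrite eq_sym -addr_eq0 addrC st.
exact: pos_starM.
Qed.

Lemma star_sum (R : realType) (A : cstarAlgType R) (I : Type) (r : seq I)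
  (F : I -> A) : star (\sum_(i <- r) F i) = \sum_(i <- r) star (F i).
Proof. exact: (big_morph _ (@starD _ A) (star0 A)). Qed.

(** * Positive matrices *)

Definition qform (R : realType) (A : cstarAlgType R) n (Q : 'I_n -> 'I_n -> A)
  (a b : 'I_n -> A) : A := \sum_i \sum_j a i * Q i j * star (b j).

Definition schur (R : realType) (A : cstarAlgType R) n
    (Q : 'I_n.+1 -> 'I_n.+1 -> A) (v : A) (i j : 'I_n) : A :=
  Q (lift ord0 i) (lift ord0 j) - Q (lift ord0 i) ord0 * v * Q ord0 (lift ord0 j).

(** Completing the square in the coordinate [ord0]. *)
Lemma qform_schur (R : realType) (A : cstarAlgType R) n
    (Q : 'I_n.+1 -> 'I_n.+1 -> A) (v : A) (a : 'I_n.+1 -> A) :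
  (forall i j, star (Q i j) = Q j i) -> star v = v ->
  v * Q ord0 ord0 = 1 -> Q ord0 ord0 * v = 1 ->
  let t := a ord0 + (\sum_i a (lift ord0 i) * Q (lift ord0 i) ord0) * v in
  qform Q a a = t * Q ord0 ord0 * star t +
    qform (schur Q v) (fun i => a (lift ord0 i)) (fun i => a (lift ord0 i)).
Proof.
move=> sQ sv vq qv /=; set l := \sum_i _; set q := Q ord0 ord0.
have sl : star l = \sum_j Q ord0 (lift ord0 j) * star (a (lift ord0 j)).
  by rewrite star_sum; apply: eq_bigr => j _; rewrite starM sQ.
have E1 : qform Q a a = a ord0 * q * star (a ord0) + a ord0 * star l +
   (l * star (a ord0) +
    \sum_i \sum_j a (lift ord0 i) * Q (lift ord0 i) (lift ord0 j) * star (a (lift ord0 j))).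
  rewrite /qform big_ord_recl big_ord_recl; congr (_ + _).
    by congr (_ + _); rewrite sl mulr_sumr; apply: eq_bigr => j _; rewrite mulrA.
  rewrite (eq_bigr (fun i => a (lift ord0 i) * Q (lift ord0 i) ord0 * star (a ord0) +
    \sum_j a (lift ord0 i) * Q (lift ord0 i) (lift ord0 j) * star (a (lift ord0 j)))).
    by rewrite big_split /= -mulr_suml.
  by move=> i _; rewrite big_ord_recl.
have E2 : qform (schur Q v) (fun i => a (lift ord0 i)) (fun i => a (lift ord0 i)) =
   \sum_i \sum_j a (lift ord0 i) * Q (lift ord0 i) (lift ord0 j) * star (a (lift ord0 j))
   - l * v * star l.
  rewrite /qform /schur.
  have -> : l * v * star l = \sum_i \sum_j a (lift ord0 i) * (Q (lift ord0 i) ord0 * v *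
      Q ord0 (lift ord0 j)) * star (a (lift ord0 j)).
    rewrite sl -mulrA mulr_suml; apply: eq_bigr => i _.
    by rewrite mulr_sumr mulr_sumr; apply: eq_bigr => j _; rewrite !mulrA.
  rewrite -sumrB; apply: eq_bigr => i _; rewrite -sumrB; apply: eq_bigr => j _.
  by rewrite mulrBr mulrBl.
rewrite E1 E2 starD starM sv; set X := \sum_i \sum_j _.
have -> : (a ord0 + l * v) * q * (star (a ord0) + v * star l) =
    a ord0 * q * star (a ord0) + a ord0 * star l + (l * star (a ord0) + l * v * star l).
  rewrite mulrDl -(mulrA l v) vq mulr1 mulrDl !mulrDr.
  by rewrite !mulrA -(mulrA (a ord0) q v) qv mulr1.
by rewrite -!addrA; do 3 congr (_ + _); rewrite [RHS]addrCA subrr addr0.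
Qed.

(** Elimination: after adding a multiple of the identity the corner of Q is
invertible in S, and [qform_schur] splits off a positive term and leaves the Schur
complement, whose values on vectors from S are values of the form itself, at
vectors for which the square term vanishes. *)
Lemma psd_extend (R : realType) (A : cstarAlgType R) (S : set A) n
    (Q : 'I_n -> 'I_n -> A) :
  S 1 -> (forall x y, S x -> S y -> S (x + y)) -> (forall x, S x -> S (- x)) ->
  (forall x y, S x -> S y -> S (x * y)) ->
  (forall x v, S x -> v * x = 1 -> x * v = 1 -> S v) ->
  (forall i j, S (Q i j)) -> (forall i j, star (Q i j) = Q j i) ->
  (forall p, (forall i, S (p i)) -> pos (qform Q p p)) ->
  forall a, pos (qform Q a a).
Proof.
move=> S1 SD SN SM SV; have S0 : S 0 by rewrite -(subrr 1); apply/SD/SN.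
have SMn x m : S x -> S (x *+ m).
  by move=> Sx; elim: m => [|m IH]; rewrite ?mulr0n// mulrS; apply: SD.
have Ssum m (F : 'I_m -> A) : (forall i, S (F i)) -> S (\sum_i F i).
  by move=> SF; elim/big_ind: _.
elim: n Q => [|n IH] Q SQ sQ pQ a.
  by rewrite /qform big_ord0; exact: (pos_nat A 0).
apply: (@pos_arch _ _ _ (\sum_i a i * star (a i))) => m.
(* regularization, which makes the corner of the matrix invertible *)
pose Q' i j := Q i j *+ m + (i == j)%:R.
have qQ' b : qform Q' b b = qform Q b b *+ m + \sum_i b i * star (b i).
  rewrite /qform -sumrMnl -big_split /=; apply: eq_bigr => i _.
  rewrite (eq_bigr (fun j => (b i * Q i j * star (b j)) *+ m +
     (if j == i then b i * star (b i) else 0))).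
    by rewrite big_split /= sumrMnl -big_mkcond big_pred1_eq.
  move=> j _; rewrite /Q' mulrDr mulrDl; congr (_ + _); first by rewrite mulrnAr mulrnAl.
  by rewrite eq_sym; case: eqP => [->|_]; rewrite ?mulr1 ?mulr0 ?mul0r.
have SQ' i j : S (Q' i j) by apply: SD; [exact: SMn|case: eqP].
have sQ' i j : star (Q' i j) = Q' j i.
  by rewrite starD star_mulrn sQ star_nat /Q' eq_sym.
have pQ' p : (forall i, S (p i)) -> pos (qform Q' p p).
  move=> Sp; rewrite qQ'; apply: posD; first by apply: posMn; exact: pQ.
  by apply: pos_sum => i _; exact: pos_mulstar.
have pq : pos (Q ord0 ord0).
  have := pQ (fun i => (i == ord0)%:R).
  rewrite /qform (bigD1 ord0)//= [X in _ + X]big1 => [|i /negPf i0]; last first.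
    by apply: big1 => j _; rewrite i0 !mul0r.
  rewrite (bigD1 ord0)//= [X in _ + X + _]big1 => [|j /negPf j0]; last first.
    by rewrite j0 star0 mulr0.
  rewrite star1 mul1r mulr1 !addr0; apply => i; case: eqP => //.
have [v [sv vq qv]] := pos_inv (posMn m pq).
have Q0 : Q' ord0 ord0 = Q ord0 ord0 *+ m + 1 by rewrite /Q' eqxx.
rewrite -Q0 in vq qv.
have Sv : S v := SV _ _ (SQ' _ _) vq qv.
rewrite -qQ' (qform_schur a sQ' sv vq qv); apply: posD.
  by apply: pos_conj; rewrite Q0; apply: posD; [exact: posMn|exact: (pos_nat A 1)].
apply: IH.
- move=> i j; apply: SD; first exact: SQ'.
  by apply/SN/SM => //; exact/SM.
- by move=> i j; rewrite starB !starM !sQ' sv mulrA.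
move=> p Sp.
pose l := \sum_i p i * Q' (lift ord0 i) ord0.
(* the value at [ord0] is the one that kills the square term of [qform_schur] *)
pose b (i : 'I_n.+1) := if unlift ord0 i is Some k then p k else - (l * v).
have Sl : S l by apply: Ssum => i; apply: SM.
have Sb i : S (b i).
  by rewrite /b; case: unlift => [k|]; [exact: Sp|apply/SN/SM].
have := pQ' b Sb; rewrite (qform_schur b sQ' sv vq qv).
have bl i : b (lift ord0 i) = p i by rewrite /b liftK.
rewrite (eq_bigr (fun i => p i * Q' (lift ord0 i) ord0)) => [|i _]; last by rewrite bl.
rewrite -/l {1 2}/b unlift_none addNr !mul0r add0r.
by have -> : (fun i => b (lift ord0 i)) = p by apply/funext.
Qed.

(** The Cauchy-Schwarz argument: with [f = d Q], the value of the form at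
[m d - f] is [- 2 m] times the sum of the [f j * star (f j)], plus a constant. *)
Lemma psd_isotropic (R : realType) (A : cstarAlgType R) n
    (Q : 'I_n -> 'I_n -> A) (d : 'I_n -> A) :
  (forall i j, star (Q i j) = Q j i) -> (forall a, pos (qform Q a a)) ->
  qform Q d d = 0 -> forall j, \sum_i d i * Q i j = 0.
Proof.
move=> sQ pQ d0; pose f j := \sum_i d i * Q i j.
pose s := \sum_j f j * star (f j).
have df : qform Q d f = s.
  rewrite /qform exchange_big /s; apply: eq_bigr => j _.
  by rewrite -mulr_suml.
have fd : qform Q f d = s.
  rewrite /qform /s; apply: eq_bigr => i _; rewrite /f star_sum mulr_sumr.
  by apply: eq_bigr => j _; rewrite starM sQ mulrA.
have qE m : qform Q (fun i => d i *+ m - f i) (fun i => d i *+ m - f i) =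
    qform Q d d *+ m *+ m - (qform Q d f *+ m + qform Q f d *+ m) + qform Q f f.
  have Bl x y z : qform Q (fun i => x i *+ m - y i) z = qform Q x z *+ m - qform Q y z.
    rewrite /qform -sumrMnl -sumrB; apply: eq_bigr => i _.
    rewrite -sumrMnl -sumrB; apply: eq_bigr => k _.
    by rewrite !mulrBl !mulrnAl.
  have Br x y z : qform Q z (fun i => x i *+ m - y i) = qform Q z x *+ m - qform Q z y.
    rewrite /qform -sumrMnl -sumrB; apply: eq_bigr => i _.
    rewrite -sumrMnl -sumrB; apply: eq_bigr => k _.
    by rewrite starB star_mulrn mulrBr mulrnAr.
  by rewrite Bl !Br mulrnBl opprB opprD !addrA [LHS]addrAC.
have ps : pos (- (s + s)).
  apply: (@pos_arch _ _ _ (qform Q f f)) => m.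
  have := pQ (fun i => d i *+ m - f i).
  by rewrite qE d0 !mul0rn add0r df fd -mulrnDl mulNrn.
move=> j; rewrite -/(f j).
suff : star (star (f j)) * star (f j) = 0.
  by move=> /cnorm_starM0 /(congr1 (@star _ A)); rewrite starK star0.
rewrite starK; apply: pos_antisym; first exact: pos_mulstar.
have pF i : pos (f i * star (f i)) by exact: pos_mulstar.
have -> : - (f j * star (f j)) =
    - (s + s) + s + \sum_(i | i != j) f i * star (f i).
  have sE : s = f j * star (f j) + \sum_(i | i != j) f i * star (f i).
    by rewrite /s (bigD1 j).
  by rewrite opprD addrNK {1}sE opprD addrNK.
by apply: posD; [apply: posD => //|]; apply: pos_sum => i _.
Qed.

(** * Conditional expectations *)

Section ConditionalExpectation.
Variables (R : realType) (A : cstarAlgType R) (P : set A) (E : condexp P).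
Hypothesis P1 : P 1.
Implicit Types x y p : A.

Lemma condexpD x y : E (x + y) = E x + E y.
Proof. by have := condexp_linear E 1 x y; rewrite !scale1r. Qed.

Lemma condexp0 : E 0 = 0.
Proof. by apply: (addrI (E 0)); rewrite -condexpD !addr0. Qed.

Lemma condexpN x : E (- x) = - E x.
Proof. by apply: (addrI (E x)); rewrite -condexpD !subrr condexp0. Qed.

Lemma condexpZ (c : R[i]) x : E (c *: x) = c *: E x.
Proof. by have := condexp_linear E c x 0; rewrite condexp0 !addr0. Qed.

Lemma condexp_sum (I : Type) (r : seq I) (F : I -> A) :
  E (\sum_(i <- r) F i) = \sum_(i <- r) E (F i).
Proof. exact: (big_morph _ condexpD condexp0). Qed.

Lemma condexpMl p x : P p -> E (p * x) = p * E x.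
Proof. by move=> Pp; rewrite -[p * x]mulr1 condexp_bimod// mulr1. Qed.

Lemma condexpMr p x : P p -> E (x * p) = E x * p.
Proof. by move=> Pp; rewrite -[x * p]mul1r mulrA condexp_bimod// mul1r. Qed.

Lemma condexp_imgP x : P x <-> E x = x.
Proof. by split=> [/condexp_id->//|<-]; exact: condexp_in. Qed.

Lemma condexp_imgD x y : P x -> P y -> P (x + y).
Proof. by move=> Px Py; apply/condexp_imgP; rewrite condexpD !condexp_id. Qed.

Lemma condexp_imgN x : P x -> P (- x).
Proof. by move=> Px; apply/condexp_imgP; rewrite condexpN condexp_id. Qed.

Lemma condexp_imgM x y : P x -> P y -> P (x * y).
Proof. by move=> Px Py; apply/condexp_imgP; rewrite condexpMl// condexp_id. Qed.

(** [E v] is also a left inverse of x, as E is a bimodule map. *)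
Lemma condexp_img_inv x v : P x -> v * x = 1 -> x * v = 1 -> P v.
Proof.
move=> Px vx xv; apply/condexp_imgP.
by rewrite -[LHS]mulr1 -[X in _ * X]xv mulrA -condexpMr// vx condexp_id// mul1r.
Qed.

Lemma condexp_starM_sa x : star (E (star x * x)) = E (star x * x).
Proof.
have [|t _ ->] := condexp_pos E (x := star x * x); first by exists x.
by rewrite starM starK.
Qed.

(** E maps [star y * y] to a self-adjoint element, hence also [y + star y], by
polarization against 1; then take y to be x and [i x]. *)
Lemma condexp_star x : E (star x) = star (E x).
Proof.
have h y : star (E (y + star y)) = E (y + star y).
  have -> : y + star y = star (y + 1) * (y + 1) - star y * y - 1.
    rewrite starD star1 mulrDl mulrDr mul1r mulr1.
    by rewrite (addrAC _ _ (- (star y * y))) (addrC (star y * y)) addrK addrA addrK addrC.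
  by rewrite !condexpB !starB !condexp_starM_sa (condexp_id _ P1) star1.
have := h ('i%C *: x).
have ci : conjc 'i%C = - 'i%C :> R[i] by apply/eqP; rewrite eq_complex /= oppr0 !eqxx.
have i0 : 'i%C != 0 :> R[i] by rewrite eq_complex /= oner_eq0 andbF.
rewrite starZ ci scaleNr -scalerBr condexpZ starZ ci scaleNr -scalerN.
move=> /(scalerI i0); rewrite condexpB starB opprB => h1.
have := h x; rewrite condexpD starD => h2.
have : E (star x) *+ 2 = star (E x) *+ 2.
  have -> : E (star x) *+ 2 = E x + E (star x) - (E x - E (star x)).
    by rewrite opprB [RHS]addrC subrKA mulr2n.
  by rewrite -h1 -h2 opprB (addrC (star (E x))) [LHS]addrC subrKA mulr2n.
rewrite -(scaler_nat 2 (E (star x))) -(scaler_nat 2 (star (E x))).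
by apply: scalerI; rewrite pnatr_eq0.
Qed.

(** Complete positivity of E.  On vectors p from P the form is the value of E at a
square, p being absorbed by the module property; [psd_extend] does the rest. *)
Lemma condexp_gram_pos n (v : 'I_n -> A) (a : 'I_n -> A) :
  pos (qform (fun i j => E (v i * star (v j))) a a).
Proof.
apply: (@psd_extend _ _ P) => //.
- exact: condexp_imgD.
- exact: condexp_imgN.
- exact: condexp_imgM.
- exact: condexp_img_inv.
- by move=> i j; exact: condexp_in.
- by move=> i j; rewrite -condexp_star starM starK.
move=> p Pp; pose z := \sum_i p i * v i.
have Psp i : P (star (p i)) by apply/condexp_imgP; rewrite condexp_star condexp_id.
have -> : qform (fun i j => E (v i * star (v j))) p p = E (z * star z).
  rewrite /qform /z mulr_suml condexp_sum; apply: eq_bigr => i _.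
  rewrite star_sum mulr_sumr condexp_sum; apply: eq_bigr => j _.
  by rewrite starM mulrA -(mulrA (p i) (v i)) condexp_bimod.
have [|t _ ->] := condexp_pos E (x := z * star z); last exact: pos_starM.
by exists (star z) => //; rewrite starK.
Qed.

End ConditionalExpectation.

(** * The retraction given by a Rokhlin projection *)

(** The projection e is required to be a Rokhlin projection only after cutting by
the central projection c; all identities below hold on the range of c. *)
Section RokhlinProjection.
Variables (R : realType) (A : cstarAlgType R) (P : set A) (E : condexp P).
Hypothesis P1 : P 1.
Variables (n : nat) (u v : 'I_n -> A).
Hypothesis uv : quasi_basis E u v.
Local Notation w := (\sum_i u i * v i).

Lemma quasi_basis_l x : \sum_i u i * E (v i * x) = x.
Proof. by have [<- _] := uv x. Qed.

Lemma quasi_basis_r x : \sum_i E (x * u i) * v i = x.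
Proof. by have [_ <-] := uv x. Qed.

Lemma index_central x : x * w = w * x.
Proof.
have -> : x * w = \sum_i \sum_j u j * E (v j * (x * u i)) * v i.
  rewrite mulr_sumr; apply: eq_bigr => i _.
  by rewrite -mulr_suml quasi_basis_l mulrA.
rewrite exchange_big /= mulr_suml; apply: eq_bigr => j _.
under eq_bigr do rewrite -mulrA mulrA.
rewrite -[in RHS]mulrA -[v j * x]quasi_basis_r mulr_sumr.
by apply: eq_bigr => i _; rewrite !mulrA.
Qed.

Variables c e : A.
Hypotheses (Pc : P c) (sc : star c = c) (cc : c * c = c).
Hypothesis c_central : forall x, c * x = x * c.
Hypotheses (se : star e = e) (ee : e * e = e).
Hypothesis cut : c * (w * E e) = c.
Local Notation W := (c * w).

Lemma cut_index_central x : W * x = x * W.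
Proof. by rewrite -mulrA -index_central mulrA c_central !mulrA; rewrite -mulrA c_central mulrA. Qed.

(** [E e] lies in P and is inverse to W on the range of c, so [E W], which is
inverse to it as well, equals W. *)
Lemma cut_index_in : P W.
Proof.
apply/(condexp_imgP E).
have WE : W * E e = c by rewrite -mulrA.
have EWc : E W * c = E W by rewrite -condexpMr// -c_central mulrA cc.
have EWE : E W * E e = c.
  by rewrite -(condexpMr E P1 _ (condexp_in E e)) WE condexp_id.
rewrite -EWc -{2}WE cut_index_central mulrA EWE.
by rewrite mulrA cc.
Qed.

Lemma cut_index_sa : star W = W.
Proof.
have WE : W * E e = c by rewrite -mulrA.
have sE : star (E e) = E e by rewrite -condexp_star// se.
have EsW : E e * star W = c.
  by have /(congr1 (@star _ A)) := WE; rewrite starM sE sc.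
have cW : c * W = W by rewrite mulrA cc.
have sWc : c * star W = star W.
  by have /(congr1 (@star _ A)) := cW; rewrite (starM c W) sc (c_central (star W)).
by rewrite -[LHS]sWc -[X in X * star _]WE -mulrA EsW -c_central.
Qed.

(** In the basic construction this says that the projection e lies under
[W e f e], with f the Jones projection of E; the vanishing sum [dw] is the dual
expectation of the difference, and [dv0] is the faithfulness of that
expectation. *)
Lemma rokhlin_compression x : c * x * e = W * E (x * e) * e.
Proof.
have [z [zW Pz sz cz ze] zC] : exists2 z, [/\ W = z, P z, star z = z, c * z = z &
    z * E e = c] & forall y, z * y = y * z.
  exists W; [split=> //|exact: cut_index_central].
  - exact: cut_index_in.
  - exact: cut_index_sa.
  - by rewrite mulrA cc.
  - by rewrite -mulrA.
rewrite zW; have Pe := condexp_in E.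
pose d y := e * (c * y - z * E (e * y)).
pose d' y := (c * y - z * E (y * e)) * e.
have dD (I : finType) (F : I -> A) : d (\sum_i F i) = \sum_i d (F i).
  by rewrite /d !mulr_sumr condexp_sum !mulr_sumr -sumrB mulr_sumr.
have dM y p : P p -> d (y * p) = d y * p.
  by move=> Pp; rewrite /d (mulrA c y) (mulrA e y) condexpMr// (mulrA z) -mulrBl mulrA.
have sd y : star (d y) = d' (star y).
  rewrite /d /d' starM starB !starM se sc sz -condexp_star// starM se.
  by rewrite (c_central (star y)) zC.
have dw : \sum_k d (u k) * d' (v k) = 0.
  have zc : z * c = z by rewrite -c_central.
  have swap (t : A) (tC : forall y, t * y = y * t) x' y : x' * (t * y) = t * (x' * y).
    by rewrite mulrA -tC mulrA.
  pose m k := c * (u k * v k) - z * (u k * E (v k * e)) -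
    (z * (E (e * u k) * v k) - z * (z * E (e * (u k * E (v k * e))))).
  have mE k : d (u k) * d' (v k) = e * m k * e.
    rewrite /d /d' !mulrA; congr (_ * e); rewrite -!mulrA; congr (e * _).
    rewrite mulrBl !mulrBr /m; congr (_ - _ - (_ - _)).
    - by rewrite (swap c) // !mulrA cc.
    - by rewrite (swap z) // !mulrA zc.
    - by rewrite (swap c) // !mulrA cz.
    - by rewrite (swap z) // (mulrA e) (condexpMr E P1 _ (Pe _)) !mulrA.
  have mS : \sum_k m k = z - z * e - (z * e - z).
    rewrite /m !sumrB -!mulr_sumr -condexp_sum -mulr_sumr.
    by rewrite quasi_basis_l quasi_basis_r ee zW ze zc.
  rewrite (eq_bigr (fun k => e * m k * e)) => [|k _]; last exact: mE.
  have ez : e * (z * e) = z * e by rewrite mulrA -zC -mulrA ee.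
  by rewrite -mulr_suml -mulr_sumr mS !mulrBr -(zC e) ez !subrr mul0r.
have dv j : d (star (v j)) = \sum_k d (u k) * E (v k * star (v j)).
  rewrite -{1}(quasi_basis_l (star (v j))) dD; apply: eq_bigr => k _.
  by rewrite dM.
have q0 : qform (fun i j => E (v i * star (v j))) (fun i => d (u i)) (fun i => d (u i)) = 0.
  have /(congr1 (@star _ A)) := dw; rewrite star_sum star0 => <-.
  rewrite /qform exchange_big /=; apply: eq_bigr => j _.
  have dE : d' (v j) = star (d (star (v j))) by rewrite sd starK.
  by rewrite -mulr_suml -dv (starM (d (u j)) (d' (v j))) dE starK.
have dv0 j : d (star (v j)) = 0.
  rewrite dv; apply: (psd_isotropic _ _ q0) => [i k|a].
    by rewrite -condexp_star// starM starK.
  exact: condexp_gram_pos.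
have cv j : c * (v j * e) = z * (E (v j * e) * e).
  have : d' (v j) = 0 by rewrite -[v j]starK -sd dv0 star0.
  by rewrite /d' mulrBl -!mulrA => /eqP; rewrite subr_eq0 => /eqP.
have xe : x * e = \sum_j E (x * u j) * (v j * e).
  by rewrite -{1}(quasi_basis_r x) mulr_suml; apply: eq_bigr => j _; rewrite mulrA.
rewrite -mulrA {1}xe mulr_sumr xe condexp_sum mulr_sumr mulr_suml.
apply: eq_bigr => j _; rewrite (condexpMl E P1 (v j * e) (Pe _)).
by rewrite mulrA c_central -mulrA cv !mulrA zC.
Qed.

Definition rokhlin_map x : A := W * E (x * e).

Lemma rokhlin_map_in x : P (rokhlin_map x).
Proof. by apply: (condexp_imgM E P1); [exact: cut_index_in|exact: condexp_in]. Qed.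

Lemma rokhlin_map_id p : P p -> rokhlin_map p = c * p.
Proof.
move=> Pp; rewrite /rokhlin_map (condexpMl E P1 e Pp) mulrA cut_index_central.
by rewrite -mulrA -mulrA cut c_central.
Qed.

(** Since y commutes with e, [E (x * y * e) = E (x * e * y)], and
[rokhlin_compression] replaces [x * e] by the image of x times e. *)
Lemma rokhlin_mapM x y : y * e = e * y ->
  rokhlin_map (x * y) = rokhlin_map x * rokhlin_map y.
Proof.
move=> ye; have PW := cut_index_in; have WC := cut_index_central.
have Pe := condexp_in E.
have cE : c * E (x * y * e) = rokhlin_map x * E (y * e).
  rewrite -(condexpMl E P1 _ Pc) -(mulrA x) ye !mulrA rokhlin_compression.
  rewrite -[_ * e * y]mulrA (condexpMl E P1 (e * y)) //.
  exact: (condexp_imgM E P1).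
have Wc : W * c = W by rewrite -c_central mulrA cc.
by rewrite {1}/rokhlin_map -{1}Wc -mulrA cE WC /rokhlin_map -!mulrA -WC -!mulrA.
Qed.

Lemma rokhlin_map_star x : x * e = e * x ->
  star (rokhlin_map x) = rokhlin_map (star x).
Proof.
move=> xe; rewrite /rokhlin_map starM cut_index_sa -(condexp_star E P1) xe.
by rewrite starM se cut_index_central.
Qed.

Lemma cnorm_rokhlin_map_sub x y :
  cnorm (rokhlin_map x - rokhlin_map y) <= cnorm W * cnorm e * cnorm (x - y).
Proof.
rewrite /rokhlin_map -mulrBr -condexpB -mulrBl (le_trans (cnormM _ _))//.
rewrite -mulrA ler_wpM2l ?cnorm_ge0// (le_trans (condexp_contr _ _))//.
by rewrite mulrC cnormM.
Qed.

(** The left hand side is the image of [star x * b * x - a], because the map sends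
b to [c * b] and its values absorb c. *)
Lemma rokhlin_map_cuntz a b x : P a -> P b ->
  b * e = e * b -> x * e = e * x ->
  cnorm (star (rokhlin_map x) * b * rokhlin_map x - c * a) <=
  cnorm W * cnorm e * cnorm (star x * b * x - a).
Proof.
move=> Pa Pb be xe.
have cm : c * rokhlin_map x = rokhlin_map x by rewrite /rokhlin_map !mulrA cc.
have -> : star (rokhlin_map x) * b * rokhlin_map x = rokhlin_map (star x * b * x).
  rewrite rokhlin_map_star// rokhlin_mapM// rokhlin_mapM// (rokhlin_map_id Pb).
  by rewrite -(mulrA _ (c * b)) (c_central b) -(mulrA b) cm mulrA.
by rewrite -(rokhlin_map_id Pa) cnorm_rokhlin_map_sub.
Qed.

End RokhlinProjection.

(** * Passage to the sequence algebra *)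

Section SequenceAlgebraLift.
Variables (R : realType) (A : cstarAlgType R) (P : set A) (E : condexp P).

Lemma star_seqpi (x : linf A) : star (seqpi x) = seqpi (linf_star x).
Proof. exact: seq_starE. Qed.

Lemma cnorm_seqpi (x : linf A) : cnorm (seqpi x) = limsup_norm x.
Proof. exact: seq_normE. Qed.

Lemma linf_eq (x y : linf A) : (forall k, x k = y k) -> x = y.
Proof. by move=> h; apply/val_inj/funext. Qed.

Definition seq_image : set (seqalg A) :=
  [set q | exists2 x : linf A, (forall k, P (x k)) & q = seqpi x].

Let ce_in q : seq_image (condexp_seq E q).
Proof. by exists (linf_condexp E (repr q)) => // k; exact: condexp_in. Qed.

Let ce_id p : seq_image p -> condexp_seq E p = p.
Proof.
move=> [x Px ->]; rewrite condexp_seqE; congr seqpi; apply: linf_eq => k.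
exact: condexp_id.
Qed.

Let ce_linear (c : R[i]) (x y : seqalg A) :
  condexp_seq E (c *: x + y) = c *: condexp_seq E x + condexp_seq E y.
Proof.
elim/seqpi_ind: x => x; elim/seqpi_ind: y => y.
rewrite -seqpiZ -seqpiD !condexp_seqE -seqpiZ -seqpiD; congr seqpi.
by apply: linf_eq => k; exact: condexp_linear.
Qed.

Let ce_bimod p q x : seq_image p -> seq_image q ->
  condexp_seq E (p * x * q) = p * condexp_seq E x * q.
Proof.
move=> [p' Pp ->] [q' Pq ->]; elim/seqpi_ind: x => x.
rewrite -seqpiM -seqpiM !condexp_seqE -!seqpiM; congr seqpi.
by apply: linf_eq => k; apply: condexp_bimod; [exact: Pp|exact: Pq].
Qed.

Let ce_contr x : cnorm (condexp_seq E x) <= cnorm x.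
Proof.
elim/seqpi_ind: x => x; rewrite condexp_seqE !cnorm_seqpi.
apply/ler_addgt0Pr => e e0; apply: limsup_norm_le.
have := @limsup_norm_lt _ _ x (limsup_norm x + e); rewrite ltrDl => /(_ e0).
apply: filterS => k /ltW; apply: le_trans; exact: condexp_contr.
Qed.

Let ce_pos x : positive_in setT x -> positive_in seq_image (condexp_seq E x).
Proof.
move=> [s _ ->]; elim/seqpi_ind: s => s.
(* square roots are chosen entrywise; they are bounded by the C*-identity *)
have /choice[t ht] : forall k, exists t, P t /\ E (star (s k) * s k) = star t * t.
  move=> k; have [|t Pt Et] := condexp_pos E (x := star (s k) * s k); first by exists (s k).
  by exists t.
have [M M0 hM] := linf_bounded s.
have tb : t \in bounded_seq A.
  apply/bounded_seqP; exists M => k; have [_ Et] := ht k.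
  rewrite -(@ler_pXn2r _ 2) ?nnegrE ?cnorm_ge0 ?(ltW M0)//.
  rewrite -cnorm_starM -Et (le_trans (condexp_contr _ _))// cnorm_starM.
  by rewrite ler_pXn2r ?nnegrE ?cnorm_ge0 ?(ltW M0).
exists (seqpi (Linf tb)); first by exists (Linf tb) => // k; case: (ht k).
rewrite !star_seqpi -!seqpiM condexp_seqE; congr seqpi.
by apply: linf_eq => k; case: (ht k).
Qed.

Definition seq_condexp : condexp seq_image :=
  CondExp ce_in ce_id ce_linear ce_bimod ce_pos ce_contr.

Lemma seq_cstM (x y : A) : seq_cst (x * y) = seq_cst x * seq_cst y.
Proof. by rewrite /seq_cst -seqpiM; congr seqpi; apply: linf_eq. Qed.

Lemma seq_cstD (x y : A) : seq_cst (x + y) = seq_cst x + seq_cst y.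
Proof. by rewrite /seq_cst -seqpiD; congr seqpi; apply: linf_eq. Qed.

Lemma seq_cst0 : seq_cst (0 : A) = 0.
Proof. by apply: (addrI (seq_cst 0)); rewrite -seq_cstD !addr0. Qed.

Lemma seq_cstN (x : A) : seq_cst (- x) = - seq_cst x.
Proof. by apply: (addrI (seq_cst x)); rewrite -seq_cstD !subrr seq_cst0. Qed.

Lemma seq_cst_star (x : A) : seq_cst (star x) = star (seq_cst x).
Proof. by rewrite /seq_cst star_seqpi; congr seqpi; apply: linf_eq. Qed.

Lemma seq_cst_sum n (F : 'I_n -> A) :
  seq_cst (\sum_i F i) = \sum_i seq_cst (F i).
Proof. exact: (big_morph _ seq_cstD seq_cst0). Qed.

Lemma cnorm_seq_cst_le (x : A) : cnorm (seq_cst x) <= cnorm x.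
Proof. by rewrite cnorm_seqpi; apply: limsup_norm_le; apply: nearW. Qed.

Lemma linf_sum n (F : 'I_n -> linf A) k : (\sum_i F i) k = \sum_i F i k.
Proof. by elim/big_rec2: _ => // i y x _ <-. Qed.

Lemma seqpi_sum n (F : 'I_n -> linf A) : seqpi (\sum_i F i) = \sum_i seqpi (F i).
Proof.
apply: (big_morph _ (@seqpiD _ A)); apply/seqpi_eq0/c0P => e e0.
by apply: nearW => k; rewrite cnorm0.
Qed.

Lemma seq_quasi_basis n (u v : 'I_n -> A) : quasi_basis E u v ->
  quasi_basis seq_condexp (fun i => seq_cst (u i)) (fun i => seq_cst (v i)).
Proof.
move=> uv; elim/seqpi_ind => x /=; split.
- rewrite (eq_bigr (fun i => seqpi (Linf (linf_cst_subproof (u i)) *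
      linf_condexp E (Linf (linf_cst_subproof (v i)) * x)))).
    rewrite -seqpi_sum; congr seqpi; apply: linf_eq => k; rewrite linf_sum.
    by have [] := uv (x k).
  by move=> i _; rewrite [RHS]seqpiM -condexp_seqE [in RHS]seqpiM.
- rewrite (eq_bigr (fun i => seqpi (
      linf_condexp E (x * Linf (linf_cst_subproof (u i))) *
      Linf (linf_cst_subproof (v i))))).
    rewrite -seqpi_sum; congr seqpi; apply: linf_eq => k; rewrite linf_sum.
    by have [] := uv (x k).
  by move=> i _; rewrite [RHS]seqpiM -condexp_seqE [in RHS]seqpiM.
Qed.

End SequenceAlgebraLift.

(** * Cutting by the even indices *)

Section EvenCut.
Variables (R : realType) (A : cstarAlgType R).

Lemma even_seq_subproof :
  (fun k => if odd k then 0 else 1 : A) \in bounded_seq A.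
Proof.
apply/bounded_seqP; exists 1 => k.
by case: ifP => _; rewrite ?cnorm0 ?cnorm1 ?ler01.
Qed.

Definition even_seq : linf A := Linf even_seq_subproof.

Definition even_cut : seqalg A := seqpi even_seq.

Lemma star_even_cut : star even_cut = even_cut.
Proof.
rewrite star_seqpi; congr seqpi; apply: linf_eq => k /=.
by case: ifP => _; rewrite ?star0 ?star1.
Qed.

Lemma even_cut_idem : even_cut * even_cut = even_cut.
Proof.
rewrite -seqpiM; congr seqpi; apply: linf_eq => k; rewrite linfM /=.
by case: ifP => _; rewrite ?mulr0 ?mulr1.
Qed.

Lemma even_cut_central (x : seqalg A) : even_cut * x = x * even_cut.
Proof.
elim/seqpi_ind: x => x; rewrite -!seqpiM; congr seqpi; apply: linf_eq => k.
by rewrite !linfM /=; case: ifP => _; rewrite ?mulr0 ?mul0r ?mulr1 ?mul1r.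
Qed.

(** The norm only sees the limit superior along the even indices, and even indices
occur arbitrarily late. *)
Lemma even_cut_entry (x : linf A) (e : R) :
  cnorm (even_cut * seqpi x) < e -> exists k, cnorm (x k) < e.
Proof.
rewrite -seqpiM cnorm_seqpi => /limsup_norm_lt[N _ HN].
have N2 : (N <= N.*2)%N by rewrite -addnn leq_addr.
exists N.*2; have : cnorm (even_seq N.*2 * x N.*2) < e := HN _ N2.
by rewrite /= odd_double mul1r.
Qed.

Lemma even_cutC_neq0 : 1 - even_cut != 0.
Proof.
apply/eqP => h; have : seqpi (1 - even_seq) = 0 by rewrite seqpiB.
move=> /seqpi_eq0/c0P/(_ 1 ltr01)[N _ HN].
have N2 : (N <= N.*2.+1)%N by rewrite -addnn leqW// leq_addr.
have : cnorm (1 - even_seq N.*2.+1) < 1 := HN _ N2.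
by rewrite /= odd_double /= subr0 cnorm1 ltxx.
Qed.

Lemma even_cutC_pos : positive_in setT (1 - even_cut).
Proof.
exists (1 - even_cut) => //; rewrite starB star1 star_even_cut.
by rewrite mulrBl mul1r mulrBr mulr1 even_cut_idem subrr subr0.
Qed.

End EvenCut.

(** If [0 <= x <= y] and [c * y = 0], with [x = star s * s] and
[y - x = star t * t], then the squares given by [c * s] and [c * t] have sum 0, so
both vanish by [starM_add_eq0]. *)
Lemma central_annihilator_hereditary (R : realType) (A : cstarAlgType R) (c : A) :
  star c = c -> (forall x, c * x = x * c) -> hereditary [set x | c * x = 0].
Proof.
move=> sc cC; split.
  split=> /=.
  - by rewrite mulr0.
  - by move=> x y cx cy; rewrite mulrDr cx cy addr0.
  - by move=> k x cx; rewrite -scalerAr cx scaler0.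
  - by move=> x y cx _; rewrite mulrA cx mul0r.
  - by move=> x cx; rewrite cC -[c]sc -starM cx star0.
  move=> x clx; apply: cnorm_eq0P => e e0.
  have c1 : 0 < cnorm c + 1 by rewrite ltr_wpDl// cnorm_ge0.
  have d0 : 0 < e / (cnorm c + 1) by rewrite divr_gt0.
  have d0' : 0 < ((e / (cnorm c + 1))%:C)%C :> R[i] by rewrite ltcR.
  have [y [/= cy]] := clx _ (nbhsx_ballx x _ d0').
  rewrite -ball_normE /= cstar_normE ltcR => xy.
  have -> : c * x = c * (x - y) by rewrite mulrBr cy subr0.
  rewrite (le_trans (cnormM _ _))//.
  rewrite (@le_trans _ _ ((cnorm c + 1) * cnorm (x - y)))//.
    by rewrite ler_wpM2r ?cnorm_ge0// lerDl.
  by rewrite -ler_pdivlMl// mulrC ltW.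
move=> x y [s _ ->] [t _ yx] /= cy.
have -> : c * (star s * s) = star s * (c * s) by rewrite !mulrA cC.
suff -> : c * s = 0 by rewrite mulr0.
apply: (@starM_add_eq0 _ _ _ (c * t)).
have cE z : star (c * z) * (c * z) = c * (c * (star z * z)).
  by rewrite starM sc -!mulrA (mulrA (star z)) -(cC (star z)) mulrA -cC !mulrA.
by rewrite !cE -!mulrDr -yx addrCA subrr addr0 cy mulr0.
Qed.

(** The projection f equivalent to [1 - g] lies in the hereditary algebra generated
by [1 - c], hence is annihilated by c; so is then the partial isometry v, and with
it [1 - g]. *)
Lemma rokhlin_even_cut (R : realType) (A : cstarAlgType R) (P : set A)
    (E : condexp P) : tracial_rokhlin E ->
  exists e : seqalg A, [/\ is_projection e, commutes_with_cst e &
    even_cut A * (seq_cst (ce_index E) * condexp_seq E e) = even_cut A].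
Proof.
move=> rE; set c := even_cut A.
have [e /= [[pe ce] _ [f [_ hf] [v [vv fv]]] _]] :=
  rE (1 - c) (even_cutC_pos A) (even_cutC_neq0 A).
exists e; split=> //; set g := _ * condexp_seq E e in vv *.
have cf : c * f = 0.
  apply: (hf _ (central_annihilator_hereditary (star_even_cut A) (@even_cut_central _ A))).
  by rewrite /= mulrBr mulr1 even_cut_idem subrr.
have cv : star (c * v) = 0.
  apply: cnorm_starM0; rewrite starK starM star_even_cut.
  by rewrite -mulrA (mulrA v) fv mulrA cf mul0r.
have : c * (1 - g) = 0.
  rewrite -vv mulrA even_cut_central -mulrA.
  by rewrite -[c * v]starK cv star0 mulr0.
by move=> /eqP; rewrite mulrBr mulr1 subr_eq0 => /eqP.
Qed.

(** The constant K depends on e and on the index only, so x can be chosen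
afterwards. *)
Lemma cuntz_approx (R : realType) (A : cstarAlgType R) (P : set A)
    (P0 : P 0) (P1 : P 1) (E : condexp P) : index_finite E -> tracial_rokhlin E ->
  forall a b : A, P a -> P b ->
  exists2 K : R, 0 <= K & forall (x : A) (d : R),
    K * cnorm (star x * b * x - a) < d ->
    exists2 y, P y & cnorm (star y * b * y - a) < d.
Proof.
move=> [n [u [v uv]]] rE a b Pa Pb.
have [e [[se ee] ce cut]] := rokhlin_even_cut rE.
move: cut; rewrite (ce_indexE uv) seq_cst_sum; under eq_bigr do rewrite seq_cstM.
set c := even_cut A => cut.
have Pcst p : P p -> seq_image P (seq_cst p) by exists (Linf (linf_cst_subproof p)).
have P1' : seq_image P 1 by exists 1.
have Pc : seq_image P c by exists (even_seq A) => // k /=; case: ifP.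
pose m := rokhlin_map (seq_condexp E) (fun i => seq_cst (u i)) (fun i => seq_cst (v i)) c e.
pose w := \sum_i seq_cst (u i) * seq_cst (v i).
exists (cnorm c * (cnorm (c * w) * cnorm e)) => [|x d xd].
  by rewrite !mulr_ge0 ?cnorm_ge0.
have [y Py my] : seq_image P (m (seq_cst x)).
  exact: (rokhlin_map_in P1' (seq_quasi_basis uv) Pc (even_cut_idem A)
    (@even_cut_central _ A) cut).
have := @rokhlin_map_cuntz _ _ _ (seq_condexp E) P1' n _ _
  (seq_quasi_basis uv) c e Pc (star_even_cut A) (even_cut_idem A)
  (@even_cut_central _ A) se ee cut (seq_cst a) (seq_cst b) (seq_cst x)
  (Pcst _ Pa) (Pcst _ Pb) (ce b) (ce x).
rewrite -/(m _) my => h.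
pose q := linf_star y * Linf (linf_cst_subproof b) * y - Linf (linf_cst_subproof a).
have qE : c * seqpi q = c * (star (seqpi y) * seq_cst b * seqpi y - c * seq_cst a).
  by rewrite seqpiB !seqpiM -star_seqpi !mulrBr [in RHS](mulrA c c) even_cut_idem.
have [|k qk] := @even_cut_entry _ A q d; last by exists (y k).
rewrite -/c qE (le_lt_trans (cnormM _ _))// (le_lt_trans _ xd)// -(mulrA (cnorm c)).
rewrite ler_wpM2l ?cnorm_ge0// (le_trans h)//.
rewrite ler_wpM2l ?mulr_ge0 ?cnorm_ge0//.
by rewrite -seq_cst_star -!seq_cstM -seq_cstN -seq_cstD cnorm_seq_cst_le.
Qed.

Theorem proposition6p2 (R : realType) (A : cstarAlgType R) (P : set A)
    (P_sub : cstar_subalgebra P) (P_unital : P 1)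
    (E : condexp P) (E_index : index_finite E) (E_rokhlin : tracial_rokhlin E)
    (a b : A) (a_pos : positive_in P a) (b_pos : positive_in P b) :
  cuntz_sub_in setT a b -> cuntz_sub_in P a b.
Proof.
have in_P x : positive_in P x -> P x.
  by move=> [s Ps ->]; apply: cstar_subM => //; exact: cstar_sub_star.
move=> [x [_ /cstar_cvgP/cvgrPdist_lt xa]].
have [K K0 approx] := cuntz_approx (cstar_sub0 P_sub) P_unital E_index E_rokhlin
  (in_P _ a_pos) (in_P _ b_pos).
have /choice[y hy] : forall k : nat, exists y,
    P y /\ cnorm (star y * b * y - a) < k.+1%:R^-1.
  move=> k; have k0 : 0 < k.+1%:R^-1 :> R by rewrite invr_gt0.
  have K1 : 0 < K + 1 by rewrite ltr_wpDl.
  have [N _ /(_ N (leqnn N))] := xa _ (divr_gt0 k0 K1).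
  rewrite /= sub0r normrN ger0_norm ?cnorm_ge0// ltr_pdivlMr// mulrC => xN.
  have [|y Py yk] := approx (x N) k.+1%:R^-1; last by exists y.
  by rewrite (le_lt_trans _ xN)// ler_wpM2r ?cnorm_ge0// lerDl.
exists y; split=> [k|]; first by case: (hy k).
apply/cstar_cvgP/cvgrPdist_lt => d d0.
exists (Num.truncn d^-1) => // k /= dk.
rewrite sub0r normrN ger0_norm ?cnorm_ge0//.
case: (hy k) => _ /lt_trans; apply.
rewrite invf_plt ?posrE//; apply: lt_le_trans (truncnS_gt _) _.
by rewrite ler_nat.
Qed.
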